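(* Let $\mathcal{JS}^{1,3}$ be the variety of complex $4$-dimensional Jordan superalgebras of type $(1,3)$ (even part of dimension $1$ with basis $e$, odd part of dimension $3$ with basis $f_1,f_2,f_3$). Then $\mathcal{JS}^{1,3}$ has dimension $12$, and it has exactly $11$ irreducible components, namely the Zariski closures $\overline{O(\mathbf J)}$ of the orbits of the following $11$ superalgebras (in particular each of them is rigid, and $\mathcal{JS}^{1,3}$ is the closure of the union of their orbits): $\mathbf J_5$: $ef_1=f_2,\ f_2f_3=e$; $\mathbf J_7$: $e^2=e$; $\mathbf J_8$: $e^2=e,\ ef_3=\frac12 f_3$; $\mathbf J_9$: $e^2=e,\ ef_3=f_3$; $\mathbf J_{11}$: $e^2=e,\ ef_2=\frac12 f_2,\ ef_3=\frac12 f_3,\ f_2f_3=e$; $\mathbf J_{12}$: $e^2=e,\ ef_2=\frac12 f_2,\ ef_3=f_3$; $\mathbf J_{14}$: $e^2=e,\ ef_2=f_2,\ ef_3=f_3,\ f_2f_3=e$; $\mathbf J_{15}$: $e^2=e,\ ef_1=\frac12 f_1,\ ef_2=\frac12 f_2,\ ef_3=\frac12 f_3$; $\mathbf J_{16}$: $e^2=e,\ ef_1=\frac12 f_1,\ ef_2=\frac12 f_2,\ ef_3=f_3$; $\mathbf J_{17}$: $e^2=e,\ ef_1=\frac12 f_1,\ ef_2=f_2,\ ef_3=f_3$; $\mathbf J_{19}$: $e^2=e,\ ef_1=f_1,\ ef_2=f_2,\ ef_3=f_3,\ f_1f_2=e$.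
   Context: All vector spaces are over $\mathbb C$. A superalgebra is a $\mathbb Z_2$-graded algebra $\mathfrak J=\mathfrak J_0\oplus\mathfrak J_1$ with $\mathfrak J_i\mathfrak J_j\subseteq\mathfrak J_{i+j}$; its type is $(\dim\mathfrak J_0,\dim\mathfrak J_1)$; $|x|=i$ for $x\in\mathfrak J_i$. It is a Jordan superalgebra if for all homogeneous $x,y,z,t$: $xy=(-1)^{|x||y|}yx$ and $$((xy)z)t+(-1)^{|y||z|+|y||t|+|z||t|}((xt)z)y+(-1)^{|x||y|+|x||z|+|x||t|+|z||t|}((yt)z)x=(xy)(zt)+(-1)^{|t|(|y|+|z|)}(xt)(yz)+(-1)^{|y||z|}(xz)(yt).$$ Multiplication tables list only nonzero products of basis vectors, up to supercommutativity ($e_i$, $e$ denote even and $f_j$, $f$ odd basis vectors; so $e f=fe$, $f_if_j=-f_jf_i$); all unlisted products are zero. Variety: fix a superspace $V=V_0\oplus V_1$ with $\dim V_0=m$, $\dim V_1=n$. The set $\mathcal{JS}^{m,n}$ of all grading-preserving multiplications $\mu:V\otimes V\to V$ that make $V$ a Jordan superalgebra is a Zariski-closed subset of the affine space (of dimension $m^3+3mn^2$) of structure constants of grading-preserving bilinear multiplications. The group $G=GL(V_0)\times GL(V_1)$ of grading-preserving linear automorphisms acts by $(g*\mu)(x\otimes y)=g\mu(g^{-1}x\otimes g^{-1}y)$; orbits correspond to isomorphism classes. $O(\mathbf J)$ denotes the orbit of a multiplication representing $\mathbf J$ and $\overline{O(\mathbf J)}$ its Zariski closure. $\mathbf J$ is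 rigid if $O(\mathbf J)$ is open in $\mathcal{JS}^{m,n}$. An irreducible component is a maximal irreducible closed subset. Dimension convention of the paper: the dimension of an orbit is taken to be $\dim O(\mathbf J)=(m+n)^2-\dim \mathfrak{Der}(\mathbf J)$, where $\mathfrak{Der}(\mathbf J)$ is the span of all even and odd superderivations, i.e. homogeneous linear maps $D$ with $D(xy)=D(x)y+(-1)^{|D||x|}xD(y)$; the dimension of the variety is the maximum of the dimensions of its components computed from these orbit dimensions. *)

(* Defs.v *)
From HB Require Import structures.
From mathcomp Require Import all_boot all_order all_algebra.
(* mpoly must be imported before all_classical: in the other order the levels
   of their notations conflict. *)
From mathcomp Require Import mpoly.
From mathcomp Require Import all_classical.
From mathcomp Require Import topology.

Set Implicit Arguments.
Unset Strict Implicit.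
Unset Printing Implicit Defensive.

Import GRing.Theory.

Local Open Scope classical_set_scope.
Local Open Scope ring_scope.

(* An alias of K^I, so that it carries the Zariski topology and no other. *)
Definition affine (K : fieldType) (I : finType) : Type := {ffun I -> K}.

HB.instance Definition _ (K : fieldType) (I : finType) :=
  Choice.on (affine K I).

Definition affine_fun (K : fieldType) (I : finType) (x : affine K I) : I -> K :=
  fun i => (x : {ffun I -> K}) i.
Coercion affine_fun : affine >-> Funclass.

Section Zariski.
Context (K : fieldType) (I : finType).

Definition poly_at (p : {mpoly K[#|I|]}) (x : affine K I) : K :=
  p.@[fun k => x (enum_val k)].

Definition zariski_open : set_system (affine K I) :=
  [set U | exists P : set {mpoly K[#|I|]},
     U = [set x | exists2 p, P p & poly_at p x != 0]].

Lemma zariski_openT : zariski_open setT.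
Proof.
exists [set (1 : {mpoly K[#|I|]})]; apply/seteqP; split=> // x _; exists 1 => //.
by rewrite /poly_at meval1 oner_neq0.
Qed.

Lemma zariski_openI : setI_closed zariski_open.
Proof.
move=> _ _ [P ->] [Q ->]; exists [set p * q | p in P & q in Q].
apply/seteqP; split=> x.
- move=> [[p Pp px] [q Qq qx]]; exists (p * q); first by exists p => //; exists q.
  by rewrite /poly_at mevalM mulf_neq0.
- move=> [_ [p Pp [q Qq <-]]]; rewrite /poly_at mevalM mulf_eq0 negb_or.
  by move=> /andP[px qx]; split; [exists p | exists q].
Qed.

Lemma zariski_open_bigU (J : Type) (f : J -> set (affine K I)) :
  (forall j, zariski_open (f j)) -> zariski_open (\bigcup_j f j).
Proof.
move=> /choice[P fP]; exists (\bigcup_j P j); apply/seteqP; split=> x.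
- by move=> [j _]; rewrite fP => -[p Pp px]; exists p => //; exists j.
- by move=> [p [j _ Pp] px]; exists j => //; rewrite fP; exists p.
Qed.

HB.instance Definition _ := isOpenTopological.Build (affine K I)
  zariski_openT zariski_openI zariski_open_bigU.

End Zariski.

Section Irreducible.
Context (T : topologicalType).
Implicit Types X Y Z : set T.

Definition open_in X Y := exists2 U, open U & Y = X `&` U.

Definition closed_in X Y := exists2 F, closed F & Y = X `&` F.

Definition irreducible Z := Z !=set0 /\
  forall A B, closed A -> closed B -> Z `<=` A `|` B -> Z `<=` A \/ Z `<=` B.

Definition irreducible_component X Z :=
  [/\ closed_in X Z, irreducible Z &
      forall Y, closed_in X Y -> irreducible Y -> Z `<=` Y -> Y = Z].

End Irreducible.

Section Superalgebra.
Context (K : fieldType) (m n : nat).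

(* V = V_0 (+) V_1, a vector being the column of its m even coordinates
   followed by its n odd ones; true stands for the odd degree. *)
Notation V := 'cV[K]_(m + n).

Definition homogeneous (i : bool) (x : V) : Prop :=
  if i then usubmx x = 0 else dsubmx x = 0.

Definition parity (i : 'I_(m + n)) : bool := (m <= i)%N.

(* The m^3 + 3 m n^2 triples (i, j, k) for which the k-th coordinate of a
   product of the i-th and j-th basis vectors is compatible with the grading. *)
Definition graded_triple : finType :=
  {t : 'I_(m + n) * 'I_(m + n) * 'I_(m + n) |
    parity t.2 == parity t.1.1 (+) parity t.1.2}.

Definition smult : Type := affine K graded_triple.
HB.instance Definition _ := Topological.on smult.

Definition structure_const (mu : smult) (i j k : 'I_(m + n)) : K :=
  if insub (i, j, k) is Some t then mu t else 0.

Definition smul (mu : smult) (x y : V) : V :=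
  \col_k \sum_i \sum_j x i 0 * y j 0 * structure_const mu i j k.

Definition supercommutative (mu : smult) : Prop :=
  forall a b x y, homogeneous a x -> homogeneous b y ->
    smul mu x y = (-1) ^+ (a && b) *: smul mu y x.

Definition super_jordan_identity (mu : smult) : Prop :=
  let: M := smul mu in
  forall a b c d x y z t, homogeneous a x -> homogeneous b y -> homogeneous c z -> homogeneous d t ->
    M (M (M x y) z) t
    + (-1) ^+ (b * c + b * d + c * d) *: M (M (M x t) z) y
    + (-1) ^+ (a * b + a * c + a * d + c * d) *: M (M (M y t) z) x
    = M (M x y) (M z t)
      + (-1) ^+ (d * (b + c)) *: M (M x t) (M y z)
      + (-1) ^+ (b * c) *: M (M x z) (M y t).

Definition jordan_superalgebras : set smult :=
  [set mu | supercommutative mu /\ super_jordan_identity mu].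

Definition graded_GL : set 'M[K]_(m + n) :=
  [set g | exists g0 g1,
     [/\ g0 \in unitmx, g1 \in unitmx & g = block_mx g0 0 0 g1]].

Definition GL_orbit (mu : smult) : set smult :=
  [set nu | exists2 g, graded_GL g & forall x y,
     smul nu x y = g *m smul mu (invmx g *m x) (invmx g *m y)].

Definition rigid (mu : smult) : Prop :=
  open_in jordan_superalgebras (GL_orbit mu).

Definition superderivation (mu : smult) (p : bool) (D : 'M[K]_(m + n)) : Prop :=
  (forall i x, homogeneous i x -> homogeneous (p (+) i) (D *m x)) /\
  forall i j x y, homogeneous i x -> homogeneous j y ->
    D *m smul mu x y
    = smul mu (D *m x) y + (-1) ^+ (p && i) *: smul mu x (D *m y).

(* U = Der(mu), the smallest subspace containing all superderivations. *)
Definition is_Der (mu : smult) (U : {vspace 'M[K]_(m + n)}) : Prop :=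
  (forall p D, superderivation mu p D -> D \in U) /\
  forall W : {vspace 'M[K]_(m + n)},
    (forall p D, superderivation mu p D -> D \in W) -> (U <= W)%VS.

(* d = (m + n)^2 - dim Der(mu). Since Der(mu) includes the odd
   superderivations, this can differ from the dimension of the orbit as an
   algebraic variety. *)
Definition orbit_dim (mu : smult) (d : nat) : Prop :=
  exists2 U, is_Der mu U & (d + \dim U = (m + n) ^ 2)%N.

Definition component_dim (Z : set smult) (d : nat) : Prop :=
  exists mu, [/\ jordan_superalgebras mu, Z = closure (GL_orbit mu) & orbit_dim mu d].

(* The maximum of the dimensions of the components, all of which are required
   to be orbit closures. *)
Definition variety_dim (d : nat) : Prop :=
  let: component := irreducible_component jordan_superalgebras in
  [/\ forall Z, component Z -> exists d', component_dim Z d',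
      exists2 Z, component Z & component_dim Z d &
      forall Z d', component Z -> component_dim Z d' -> (d' <= d)%N].

(* The multiplication given by a table of products: (i, j, k, a) records the
   term a e_k of the product e_i e_j, as well as the term of e_j e_i that
   supercommutativity then dictates. *)
Definition of_table
    (s : seq ('I_(m + n) * 'I_(m + n) * 'I_(m + n) * K)) : smult :=
  [ffun t : graded_triple => \sum_(r <- s)
    let: (i, j, k, a) := r in
    if val t == (i, j, k) then a
    else if val t == (j, i, k) then (-1) ^+ (parity i && parity j) * a
    else 0].

End Superalgebra.

Arguments jordan_superalgebras : clear implicits.

Section Type13.
Context (K : fieldType).

Let e : 'I_(1 + 3) := lshift 3 ord0.
Let f1 : 'I_(1 + 3) := rshift 1 (@Ordinal 3 0 isT).
Let f2 : 'I_(1 + 3) := rshift 1 (@Ordinal 3 1 isT).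
Let f3 : 'I_(1 + 3) := rshift 1 (@Ordinal 3 2 isT).

Definition J5 : smult K 1 3 := of_table [:: (e, f1, f2, 1); (f2, f3, e, 1)].

Definition J7 : smult K 1 3 := of_table [:: (e, e, e, 1)].

Definition J8 : smult K 1 3 := of_table [:: (e, e, e, 1); (e, f3, f3, 2^-1)].

Definition J9 : smult K 1 3 := of_table [:: (e, e, e, 1); (e, f3, f3, 1)].

Definition J11 : smult K 1 3 := of_table
  [:: (e, e, e, 1); (e, f2, f2, 2^-1); (e, f3, f3, 2^-1); (f2, f3, e, 1)].

Definition J12 : smult K 1 3 := of_table
  [:: (e, e, e, 1); (e, f2, f2, 2^-1); (e, f3, f3, 1)].

Definition J14 : smult K 1 3 := of_table
  [:: (e, e, e, 1); (e, f2, f2, 1); (e, f3, f3, 1); (f2, f3, e, 1)].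

Definition J15 : smult K 1 3 := of_table
  [:: (e, e, e, 1); (e, f1, f1, 2^-1); (e, f2, f2, 2^-1); (e, f3, f3, 2^-1)].

Definition J16 : smult K 1 3 := of_table
  [:: (e, e, e, 1); (e, f1, f1, 2^-1); (e, f2, f2, 2^-1); (e, f3, f3, 1)].

Definition J17 : smult K 1 3 := of_table
  [:: (e, e, e, 1); (e, f1, f1, 2^-1); (e, f2, f2, 1); (e, f3, f3, 1)].

Definition J19 : smult K 1 3 := of_table
  [:: (e, e, e, 1); (e, f1, f1, 1); (e, f2, f2, 1); (e, f3, f3, 1);
      (f1, f2, e, 1)].

Definition J_list : 11.-tuple (smult K 1 3) :=
  [tuple J5; J7; J8; J9; J11; J12; J14; J15; J16; J17; J19].

End Type13.

(* Main.v *)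
(* Write [e^2 = al e], [e f = A f], [f_i f_j = B_ij e], so that a multiplication is a
   triple [(al, A, B)]. The Jordan identity contains [A (2A - al) (A - al) = 0].
   If [al <> 0], then [A] is diagonalizable with eigenvalues 0, al/2, al, the
   remaining identities leave thirteen isomorphism classes, and three of them (the
   ones with [B = 0] and the spectrum of J11, J14 or J19) lie in the closures
   of J11, J14 and J19. The spectrum is read off [4 tr A^2 / al^2], so each of the
   other ten orbits is cut out by the nonvanishing of polynomials.
   If [al = 0] and [A^2 = 0], then [A] has rank at most one and the algebra is a
   limit of algebras isomorphic to J5; if [al = 0] and [A^2 <> 0], then [B = 0] and
   it is a limit of algebras isomorphic to J12. The orbit of J5 is open because only
   there does [e] move the radical of [B] out of itself.
   Limits and the irreducibility of orbits come from rational curves: a polynomial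
   vanishing at all but finitely many points of one vanishes on all of it. *)

Require Import Defs.
From mathcomp Require Import all_boot all_order all_algebra.
From mathcomp Require Import mpoly.
From mathcomp Require Import all_classical all_reals.
From mathcomp Require Import topology.
From mathcomp Require Import complex.
From mathcomp Require Import ring.
Set Implicit Arguments.
Unset Strict Implicit.
Unset Printing Implicit Defensive.

Import Order.TTheory GRing.Theory Num.Theory.

Local Open Scope classical_set_scope.
Local Open Scope ring_scope.

(** * Rational curves and Zariski closures *)

(** The components follow formally once the eleven orbits are pairwise disjoint, open in the
    variety, and have irreducible closures that cover it. Openness is the delicate point: fixing a
    spectrum is a closed condition. But if [al <> 0], the Jordan identity leaves only finitely many
    spectra, so one of them can be isolated by excluding the others. The Jordan identity is
    symmetric in [x], [y], [t] up to signs, so only the parity of [z] and the number of odd vectors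
    among the other three matter. Two of these eight cases are trivial and six give the equations on
    the triple. The dimension is not read off the topology. A component is measured by any algebra
    whose orbit closure it is, and rigidity brings such an algebra back into the listed orbit. Each
    listed algebra has four independent superderivations, which bounds the orbit dimensions by 16 -
    4 = 12; for [J12] these four, one of them odd, span all superderivations. Every normalisation
    divides but extracts no root, so the work is done over a [numFieldType], where characteristic
    zero supplies infinitely many parameters. *)

Lemma poly_nonroot (K : numFieldType) (p : {poly K}) :
  p != 0 -> exists t, p.[t] != 0.
Proof.
move=> p0; apply: contrapT => /forallNP H.
pose rs := [seq i%:R : K | i <- iota 0 (size p)].
have urs : uniq rs.
  by rewrite map_inj_uniq ?iota_uniq// => i j /eqP; rewrite eqr_nat => /eqP.
have ars : all (root p) rs.
  by apply/allP => t _; apply/rootP/eqP; apply: contrapT => /negP /H.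
by have := max_poly_roots p0 ars urs; rewrite size_map size_iota ltnn.
Qed.

Section PolynomialFunctions.
Context (K : fieldType) (I : finType).
Implicit Types (f g : affine K I -> K) (C : set (affine K I)).

Definition polyfun f := exists p, forall x, f x = poly_at p x.

Lemma polyfunC c : polyfun (fun=> c).
Proof. by exists (mpolyC _ c) => x; rewrite /poly_at mevalC. Qed.

Lemma polyfun_coord i : polyfun (fun x => x i).
Proof.
by exists (mpolyX K (mnm1 (enum_rank i))) => x;
  rewrite /poly_at mevalXU enum_rankK.
Qed.

Lemma polyfunD f g : polyfun f -> polyfun g -> polyfun (fun x => f x + g x).
Proof.
by move=> [p fp] [q gq]; exists (p + q) => x; rewrite fp gq /poly_at mevalD.
Qed.

Lemma polyfunM f g : polyfun f -> polyfun g -> polyfun (fun x => f x * g x).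
Proof.
by move=> [p fp] [q gq]; exists (p * q) => x; rewrite fp gq /poly_at mevalM.
Qed.

Lemma polyfun_ext f g : f =1 g -> polyfun f -> polyfun g.
Proof. by move=> /funext ->. Qed.

Lemma polyfunB f g : polyfun f -> polyfun g -> polyfun (fun x => f x - g x).
Proof.
move=> pf pg; apply: (@polyfun_ext (fun x => f x + (-1) * g x)).
  by move=> x; rewrite mulN1r.
by apply: polyfunD => //; apply: polyfunM => //; apply: polyfunC.
Qed.

Lemma polyfun_sum (J : Type) (r : seq J) (P : pred J) (f : J -> affine K I -> K) :
  (forall j, polyfun (f j)) -> polyfun (fun x => \sum_(j <- r | P j) f j x).
Proof.
move=> pf; elim: r => [|j r IH].
  by apply: polyfun_ext (polyfunC 0) => x; rewrite big_nil.
case Pj: (P j); last by apply: polyfun_ext IH => x; rewrite big_cons Pj.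
by apply: polyfun_ext (polyfunD (pf j) IH) => x; rewrite big_cons Pj.
Qed.

Lemma polyfun_prod (J : Type) (r : seq J) (P : pred J) (f : J -> affine K I -> K) :
  (forall j, polyfun (f j)) -> polyfun (fun x => \prod_(j <- r | P j) f j x).
Proof.
move=> pf; elim: r => [|j r IH].
  by apply: polyfun_ext (polyfunC 1) => x; rewrite big_nil.
case Pj: (P j); last by apply: polyfun_ext IH => x; rewrite big_cons Pj.
by apply: polyfun_ext (polyfunM (pf j) IH) => x; rewrite big_cons Pj.
Qed.

Lemma open_neq0 f : polyfun f -> open [set x | f x != 0].
Proof.
move=> [p fp]; exists [set p]; apply/seteqP; split=> x /=.
  by move=> fx; exists p => //; rewrite -fp.
by move=> [q ->]; rewrite -fp.
Qed.

Lemma closed_eq0 f : polyfun f -> closed [set x | f x = 0].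
Proof.
move=> pf; rewrite -openC.
rewrite (_ : ~` _ = [set x | f x != 0]); first exact: open_neq0.
by apply/seteqP; split=> x /= /eqP.
Qed.

Lemma closed_separate C x : closed C -> ~ C x ->
  exists p, poly_at p x != 0 /\ forall y, C y -> poly_at p y = 0.
Proof.
rewrite -openC => -[P CP] Cx.
have : (~` C) x by [].
rewrite CP => -[p Pp px]; exists p; split=> // y Cy.
apply/eqP; apply: contrapT => /negP py.
by have : (~` C) y by rewrite CP; exists p.
Qed.

(* [gam] is unconstrained at the roots of the common denominator [d]. *)
Definition rational_curve (gam : K -> affine K I) (n : I -> {poly K}) (d : {poly K}) :=
  forall t, d.[t] != 0 -> forall i, d.[t] * gam t i = (n i).[t].

(** Clearing denominators: a monomial costs [d] to the power of its degree, and a sum is brought to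
    a common power by multiplying crosswise. *)
Lemma poly_at_rational_curve gam n d p : rational_curve gam n d ->
  exists N, exists q : {poly K},
    forall t, d.[t] != 0 -> q.[t] = d.[t] ^+ N * poly_at p (gam t).
Proof.
move=> gamP.
elim/mpolyind: p => [|c m p _ _ [N [q qP]]].
  by exists 0%N; exists 0 => t _; rewrite /poly_at meval0 mulr0 horner0.
have [M [r rP]] : exists M, exists r : {poly K}, forall t, d.[t] != 0 ->
    r.[t] = d.[t] ^+ M * poly_at (mpolyX K m) (gam t).
  exists (\sum_i m i)%N; exists (\prod_i n (enum_val i) ^+ m i) => t dt.
  rewrite /poly_at mevalX horner_prod -prodrXr -big_split /=.
  by apply: eq_bigr => i _; rewrite horner_exp -gamP// exprMn.
exists (M + N)%N; exists (c *: r * d ^+ N + q * d ^+ M) => t dt.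
rewrite /poly_at mevalD mevalZ !hornerE rP// qP//.
by rewrite /poly_at exprD; ring.
Qed.

End PolynomialFunctions.

Section Curves.
Context (K : numFieldType) (I : finType).
Implicit Types (C X : set (affine K I)) (gam : K -> affine K I).

(** With a [c] that vanishes at the parameter of interest this is a limit argument: a polynomial
    separating that point from [C] would pull back to a nonzero [q] vanishing wherever [c] and [d]
    do not. *)
Lemma rational_curve_in_closed C gam n d (c : {poly K}) :
  closed C -> rational_curve gam n d -> c != 0 ->
  (forall t, c.[t] != 0 -> d.[t] != 0 -> C (gam t)) ->
  forall t, d.[t] != 0 -> C (gam t).
Proof.
move=> Ccl gamP c0 Cgam t0 dt0; apply: contrapT.
move=> /(closed_separate Ccl)[p [pt0 pC]].
have [N [q qP]] := poly_at_rational_curve p gamP.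
have q0 : q != 0.
  apply: contra_neq pt0 => q0; have := qP _ dt0.
  rewrite q0 horner0 => /esym/eqP; rewrite mulf_eq0 expf_eq0 (negPf dt0) andbF.
  by move=> /eqP.
have d0 : d != 0 by apply: contra_neq dt0 => ->; rewrite horner0.
have [t] := poly_nonroot (mulf_neq0 (mulf_neq0 c0 d0) q0).
rewrite !hornerM !mulf_eq0 !negb_or => /andP[/andP[ct dt]].
by rewrite qP// (pC (gam t)) ?mulr0 ?eqxx//; apply: Cgam.
Qed.

(** If [x] is outside [A] and [y] outside [B], the two separating polynomials pull back to nonzero
    polynomials in [t]. At a common nonroot the curve is outside [A] and [B] but still in [X]. *)
Lemma irreducible_closure_curves X : X !=set0 ->
  (forall x y, X x -> X y -> exists gam n d,
    [/\ rational_curve gam n d, d.[0] != 0, d.[1] != 0, gam 0 = x /\ gam 1 = y &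
        forall t, d.[t] != 0 -> X (gam t)]) ->
  irreducible (closure X).
Proof.
move=> [z Xz] curve; split; first by exists z; apply: subset_closure.
move=> A B Acl Bcl AB.
suff [XA|XB] : X `<=` A \/ X `<=` B.
- by left; rewrite ((closure_id A).1 Acl); apply: closure_subset.
- by right; rewrite ((closure_id B).1 Bcl); apply: closure_subset.
apply: contrapT => /not_orP[/existsNP[x /not_implyP[Xx Ax]] /existsNP[y /not_implyP[Xy By]]].
have [gam [n [d [gamP d0 d1 [gam0 gam1] Xgam]]]] := curve x y Xx Xy.
have [p [px pA]] := closed_separate Acl Ax.
have [q [qy qB]] := closed_separate Bcl By.
have [N [P PE]] := poly_at_rational_curve p gamP.
have [M [Q QE]] := poly_at_rational_curve q gamP.
have P0 : P != 0.
  apply: contra_neq px => P0; have := PE _ d0; rewrite P0 horner0 gam0.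
  by move=> /esym/eqP; rewrite mulf_eq0 expf_eq0 (negPf d0) andbF => /eqP.
have Q0 : Q != 0.
  apply: contra_neq qy => Q0; have := QE _ d1; rewrite Q0 horner0 gam1.
  by move=> /esym/eqP; rewrite mulf_eq0 expf_eq0 (negPf d1) andbF => /eqP.
have dn0 : d != 0 by apply: contra_neq d0 => ->; rewrite horner0.
have [t] := poly_nonroot (mulf_neq0 (mulf_neq0 P0 Q0) dn0).
rewrite !hornerM !mulf_eq0 !negb_or => /andP[/andP[Pt Qt] dt].
have [/pA pt|/qB qt] := AB _ (subset_closure (Xgam t dt)).
- by move: Pt; rewrite PE// pt mulr0 eqxx.
- by move: Qt; rewrite QE// qt mulr0 eqxx.
Qed.

End Curves.

(** * Irreducible components of a closed set covered by finitely many orbit closures *)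

Section OrbitComponents.
Context (T : topologicalType) (X : set T) (k : nat) (O : 'I_k -> set T).

Lemma irreducible_in_bigcup (Z : set T) :
  irreducible Z -> Z `<=` \bigcup_i closure (O i) -> exists i, Z `<=` closure (O i).
Proof.
move=> [[z Zz] irr] ZO; suff H : forall s : seq 'I_k,
    Z `<=` \bigcup_(i in [set` s]) closure (O i) -> exists i, Z `<=` closure (O i).
  by apply: (H (enum 'I_k)) => x /ZO[i _ ?]; exists i => //=; rewrite mem_enum.
elim=> [|i s IH] Zs; first by have [] := Zs z Zz.
have scl : closed (\bigcup_(j in [set` s]) closure (O j)).
  by apply: closed_bigcup => // j _; exact: closed_closure.
have [] := irr _ _ (@closed_closure _ (O i)) scl.
- move=> x /Zs[j /=]; rewrite inE => /orP[/eqP->|js] Ox; first by left.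
  by right; exists j.
- by exists i.
- exact: IH.
Qed.

Hypothesis Xcl : closed X.
Hypothesis OX : forall i, O i `<=` X.
Hypothesis Oirr : forall i, irreducible (closure (O i)).
Hypothesis Oopen : forall i, open_in X (O i).
Hypothesis Oorb : forall i j, O i `&` O j !=set0 -> i = j.
Hypothesis XO : X `<=` \bigcup_i closure (O i).

(** An open set cutting out [O i] in [X] is a neighbourhood of [x], hence meets [O j], and
    disjointness applies. *)
Lemma meet_closure_orbit i j : O i `&` closure (O j) !=set0 -> i = j.
Proof.
move=> [x [Ox xO]]; have [U oU OU] := Oopen i.
have Ux : U x by move: Ox; rewrite OU => -[].
have [y [Oy Uy]] := xO U (open_nbhs_nbhs (conj oU Ux)).
by apply: Oorb; exists y; split => //; rewrite OU; split=> //; apply: OX Oy.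
Qed.

Lemma O_nonempty i : O i !=set0.
Proof.
have [[x xO] _] := Oirr i; have [y [Oy _]] := xO setT filterT.
by exists y.
Qed.

Lemma closure_sub_eq i j : closure (O i) `<=` closure (O j) -> i = j.
Proof.
move=> sub; have [x Ox] := O_nonempty i; apply: meet_closure_orbit.
by exists x; split=> //; apply/sub/subset_closure.
Qed.

Lemma closureO_sub i : closure (O i) `<=` X.
Proof. by rewrite ((closure_id X).1 Xcl); apply: closure_subset. Qed.

(** By finiteness an irreducible set lies in a single closure, so a maximal one equals it. Each
    closure is itself maximal because inclusion between two closures forces equal indices. *)
Lemma components_closure_orbits :
  [set Z | irreducible_component X Z] = [set closure (O i) | i in [set: 'I_k]].
Proof.
have cl i : closed_in X (closure (O i)).
  exists (closure (O i)); first exact: closed_closure.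
  by rewrite setIC; apply/esym/setIidl/closureO_sub.
apply/seteqP; split=> Z /=.
- move=> [[F Fcl ZF] Zirr Zmax].
  have ZX : Z `<=` X by rewrite ZF; apply: subIsetl.
  have [i Zi] := irreducible_in_bigcup Zirr (subset_trans ZX XO).
  by exists i => //; apply: Zmax.
- move=> [i _ <-]; split=> // Y [F Fcl YF] Yirr iY.
  have YX : Y `<=` X by rewrite YF; apply: subIsetl.
  have [j Yj] := irreducible_in_bigcup Yirr (subset_trans YX XO).
  have ij := closure_sub_eq (subset_trans iY Yj).
  by apply/seteqP; split=> //; rewrite ij.
Qed.

End OrbitComponents.

(** * Orbits of graded multiplications *)

Section GradedMultiplications.
Context (K : fieldType) (m n : nat).
Notation V := 'cV[K]_(m + n).
Implicit Types (mu nu : smult K m n) (x y z t : V) (g h : 'M[K]_(m + n)).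

Lemma smulE mu x y k :
  smul mu x y k 0 = \sum_i \sum_j x i 0 * y j 0 * structure_const mu i j k.
Proof. by rewrite mxE. Qed.

Lemma smulDl mu x y z : smul mu (x + y) z = smul mu x z + smul mu y z.
Proof.
apply/colP => k; rewrite smulE [RHS]mxE !smulE -big_split; apply: eq_bigr => i _.
by rewrite -big_split; apply: eq_bigr => j _; rewrite mxE !mulrDl.
Qed.

Lemma smulDr mu x y z : smul mu x (y + z) = smul mu x y + smul mu x z.
Proof.
apply/colP => k; rewrite smulE [RHS]mxE !smulE -big_split; apply: eq_bigr => i _.
by rewrite -big_split; apply: eq_bigr => j _; rewrite mxE mulrDr !mulrDl.
Qed.

Lemma smulZl mu a x y : smul mu (a *: x) y = a *: smul mu x y.
Proof.
apply/colP => k; rewrite smulE [RHS]mxE !smulE big_distrr; apply: eq_bigr => i _.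
by rewrite big_distrr; apply: eq_bigr => j _; rewrite mxE /= !mulrA.
Qed.

Lemma smulZr mu a x y : smul mu x (a *: y) = a *: smul mu x y.
Proof.
apply/colP => k; rewrite smulE [RHS]mxE !smulE big_distrr; apply: eq_bigr => i _.
by rewrite big_distrr; apply: eq_bigr => j _; rewrite mxE /=; ring.
Qed.

Lemma smul_delta mu i j k :
  smul mu (delta_mx i 0) (delta_mx j 0) k 0 = structure_const mu i j k.
Proof.
rewrite smulE (bigD1 i)//= [X in _ + X]big1 => [|i' /negPf ni].
  rewrite addr0 (bigD1 j)//= [X in _ + X]big1 => [|j' /negPf nj].
    by rewrite addr0 !mxE !eqxx !mul1r.
  by rewrite !mxE nj /= mulr0 mul0r.
by rewrite big1// => j' _; rewrite !mxE ni /= !mul0r.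
Qed.

Lemma structure_constE mu (t : graded_triple m n) :
  structure_const mu (val t).1.1 (val t).1.2 (val t).2 = mu t.
Proof.
rewrite /structure_const; case: insubP => [u _ ut|].
  by congr (affine_fun _ _); apply: val_inj; rewrite ut; case: (val t) => [[]].
by rewrite (valP t).
Qed.

Lemma structure_const_odd mu i j k :
  parity k != parity i (+) parity j -> structure_const mu i j k = 0.
Proof. by rewrite /structure_const; case: insubP => // u /= ->. Qed.

Lemma smult_eqP mu nu :
  (forall i j k, structure_const mu i j k = structure_const nu i j k) -> mu = nu.
Proof. by move=> E; apply/ffunP => t; have := E (val t).1.1 (val t).1.2 (val t).2; rewrite !structure_constE. Qed.

Lemma smul_inj mu nu : (forall x y, smul mu x y = smul nu x y) -> mu = nu.
Proof. by move=> E; apply: smult_eqP => i j k; rewrite -!smul_delta E. Qed.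

Lemma homogeneousP p x :
  homogeneous p x <-> forall k, parity k != p -> x k 0 = 0.
Proof.
rewrite /homogeneous /parity; case: p; split.
- move=> x0 k; rewrite eqb_id -ltnNge => km.
  by have /colP/(_ (Ordinal km)) := x0; rewrite !mxE => <-; congr (x _ _); apply: val_inj.
- move=> H; apply/colP => k; rewrite !mxE H// eqb_id -ltnNge /=; exact: ltn_ord.
- move=> x0 k; rewrite eqbF_neg negbK => mk.
  have kn : (k - m < n)%N by rewrite ltn_subLR// ltn_ord.
  have /colP/(_ (Ordinal kn)) := x0; rewrite !mxE => <-; congr (x _ _); apply: val_inj => /=.
  by rewrite subnKC.
- by move=> H; apply/colP => k; rewrite !mxE H//= leq_addr.
Qed.

Lemma homogeneous_delta k : homogeneous (parity k) (delta_mx k 0 : V).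
Proof.
by apply/homogeneousP => l; rewrite mxE; case: (eqVneq l k) => [->|]//; rewrite eqxx.
Qed.

Lemma homogeneous_smul mu p q x y :
  homogeneous p x -> homogeneous q y -> homogeneous (p (+) q) (smul mu x y).
Proof.
move=> /homogeneousP hx /homogeneousP hy; apply/homogeneousP => k kpq.
rewrite smulE big1// => i _; rewrite big1// => j _.
have [ip|/hx->] := eqVneq (parity i) p; last by rewrite !mul0r.
have [jq|/hy->] := eqVneq (parity j) q; last by rewrite mulr0 mul0r.
by rewrite structure_const_odd ?mulr0// ip jq.
Qed.

Lemma graded_GL_unit g : graded_GL g -> g \in unitmx.
Proof.
move=> [g0 [g1 [u0 u1 ->]]].
by rewrite unitmxE det_ublock unitrM -!unitmxE u0 u1.
Qed.

Lemma graded_GL1 : graded_GL (1%:M : 'M[K]_(m + n)).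
Proof. by exists 1%:M; exists 1%:M; rewrite !unitmx1 -scalar_mx_block. Qed.

Lemma graded_GLM g h : graded_GL g -> graded_GL h -> graded_GL (g *m h).
Proof.
move=> [g0 [g1 [u0 u1 ->]]] [h0 [h1 [v0 v1 ->]]].
exists (g0 *m h0); exists (g1 *m h1); split; rewrite ?unitmx_mul ?u0 ?u1 ?v0 ?v1//.
by rewrite mulmx_block !mulmx0 !mul0mx !addr0 !add0r.
Qed.

Lemma graded_GLV g : graded_GL g -> graded_GL (invmx g).
Proof.
move=> gg; have ug := graded_GL_unit gg; case: gg => [g0 [g1 [u0 u1 gE]]].
exists (invmx g0); exists (invmx g1); rewrite !unitmx_inv; split=> //.
have E : g *m block_mx (invmx g0) 0 0 (invmx g1) = 1%:M.
  by rewrite gE mulmx_block !mulmx0 !mul0mx !addr0 !add0r !mulmxV// -scalar_mx_block.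
by rewrite -[LHS]mulmx1 -E mulKmx.
Qed.

Lemma homogeneous_graded_GL g p x :
  graded_GL g -> homogeneous p x -> homogeneous p (g *m x).
Proof.
move=> [g0 [g1 [_ _ ->]]]; rewrite -[x]vsubmxK mul_block_col !mul0mx.
by rewrite /homogeneous; case: p; rewrite ?col_mxKu ?col_mxKd => ->;
  rewrite mulmx0 ?addr0.
Qed.

(** The intertwining form has no inverses and composes directly. *)
Lemma GL_orbitP mu nu : GL_orbit mu nu <-> exists2 g, graded_GL g &
  forall x y, smul nu (g *m x) (g *m y) = g *m smul mu x y.
Proof.
split=> -[g gg E]; exists g => // x y; have ug := graded_GL_unit gg.
  by rewrite E !mulKmx.
by rewrite -E !mulKVmx.
Qed.

Lemma GL_orbit_refl mu : GL_orbit mu mu.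
Proof. by apply/GL_orbitP; exists 1%:M; [exact: graded_GL1|move=> x y; rewrite !mul1mx]. Qed.

Lemma GL_orbit_trans mu nu rho :
  GL_orbit mu nu -> GL_orbit nu rho -> GL_orbit mu rho.
Proof.
move=> /GL_orbitP[g gg E] /GL_orbitP[h hh F]; apply/GL_orbitP.
by exists (h *m g) => [|x y]; [exact: graded_GLM | rewrite -!mulmxA F E].
Qed.

Lemma GL_orbit_sym mu nu : GL_orbit mu nu -> GL_orbit nu mu.
Proof.
move=> [g gg E]; apply/GL_orbitP; exists (invmx g); first exact: graded_GLV.
by move=> x y; rewrite E mulKmx // graded_GL_unit.
Qed.

Lemma jordan_GL_orbit mu nu :
  GL_orbit mu nu -> jordan_superalgebras K m n mu -> jordan_superalgebras K m n nu.
Proof.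
move=> [g gg E] [sc ji]; have ug := graded_GL_unit gg; have gV := graded_GLV gg.
split=> [a b x y hx hy|a b c d x y z t hx hy hz ht].
  rewrite !E (sc a b) ?scalemxAr//; exact: homogeneous_graded_GL.
rewrite !E !mulKmx// !scalemxAr -!mulmxDr; congr (_ *m _).
by apply: ji; exact: homogeneous_graded_GL.
Qed.

(** The action of [g], as an element of [smult]. Only constants at graded triples are recorded, so
    this is the transported product when [g] is graded. *)
Definition transport g mu : smult K m n :=
  [ffun t : graded_triple m n =>
    (g *m smul mu (invmx g *m delta_mx (val t).1.1 0)
                  (invmx g *m delta_mx (val t).1.2 0)) (val t).2 0].

Lemma smul_lin2 mu (f : V -> V -> V) :
  (forall x y z, f (x + y) z = f x z + f y z) ->
  (forall x y z, f x (y + z) = f x y + f x z) ->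
  (forall a x y, f (a *: x) y = a *: f x y) ->
  (forall a x y, f x (a *: y) = a *: f x y) ->
  (forall i j, smul mu (delta_mx i 0) (delta_mx j 0) = f (delta_mx i 0) (delta_mx j 0)) ->
  forall x y, smul mu x y = f x y.
Proof.
move=> fDl fDr fZl fZr E x y.
have f0l z : f 0 z = 0 by have := fZl 0 0 z; rewrite !scale0r.
have f0r z : f z 0 = 0 by have := fZr 0 z 0; rewrite !scale0r.
have s0l z : smul mu 0 z = 0 by have := smulZl mu 0 0 z; rewrite !scale0r.
have s0r z : smul mu z 0 = 0 by have := smulZr mu 0 z 0; rewrite !scale0r.
rewrite (matrix_sum_delta x) (matrix_sum_delta y).
rewrite (big_morph (fun x => smul mu x _) (fun _ _ => smulDl _ _ _ _) (s0l _)).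
rewrite (big_morph (fun x => f x _) (fun _ _ => fDl _ _ _) (f0l _)).
apply: eq_bigr => i _; rewrite !big_ord1 smulZl fZl; congr (_ *: _).
rewrite (big_morph (fun y => smul mu _ y) (fun _ _ => smulDr _ _ _ _) (s0r _)).
rewrite (big_morph (fun y => f _ y) (fun _ _ => fDr _ _ _) (f0r _)).
by apply: eq_bigr => j _; rewrite !big_ord1 smulZr fZr E.
Qed.

Lemma smul_transport g mu x y : graded_GL g ->
  smul (transport g mu) x y = g *m smul mu (invmx g *m x) (invmx g *m y).
Proof.
move=> gg; move: x y; apply: smul_lin2 => [x y z|x y z|a x y|a x y|i j] /=.
- by rewrite mulmxDr smulDl mulmxDr.
- by rewrite mulmxDr smulDr mulmxDr.
- by rewrite -scalemxAr smulZl -scalemxAr.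
- by rewrite -scalemxAr smulZr -scalemxAr.
apply/colP => k; rewrite smul_delta.
have [kij|kij] := eqVneq (parity k) (parity i (+) parity j).
  have kij' : (fun t : 'I_(m + n) * 'I_(m + n) * 'I_(m + n) =>
      parity t.2 == parity t.1.1 (+) parity t.1.2) (i, j, k) by rewrite /= kij.
  by have := structure_constE (transport g mu) (exist _ (i, j, k) kij'); rewrite /affine_fun ffunE.
rewrite structure_const_odd//; apply/esym; move: k kij; apply/homogeneousP.
apply: homogeneous_graded_GL => //; have gV := graded_GLV gg.
by apply: homogeneous_smul; apply: homogeneous_graded_GL => //; exact: homogeneous_delta.
Qed.

End GradedMultiplications.

(** * Closedness of the Jordan condition *)

Section JordanClosed.
Context (K : fieldType) (m n : nat).
Notation V := 'cV[K]_(m + n).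
Implicit Types (F G : smult K m n -> V).

Lemma polyfun_structure_const i j k :
  polyfun (fun mu : smult K m n => structure_const mu i j k).
Proof.
rewrite /structure_const; case: insub => [t|]; first exact: polyfun_coord.
exact: polyfunC.
Qed.

Definition polyvec F := forall k, polyfun (fun mu : affine _ _ => F mu k 0).

Lemma polyvec_cst x : polyvec (fun=> x).
Proof. by move=> k; apply: polyfunC. Qed.

Lemma polyvecD F G : polyvec F -> polyvec G -> polyvec (fun mu => F mu + G mu).
Proof.
move=> pF pG k; apply: (polyfun_ext _ (polyfunD (pF k) (pG k))) => mu.
by rewrite mxE.
Qed.

Lemma polyvecZ a F : polyvec F -> polyvec (fun mu => a *: F mu).
Proof.
move=> pF k; apply: (polyfun_ext _ (polyfunM (polyfunC _ a) (pF k))) => mu.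
by rewrite mxE.
Qed.

Lemma polyvec_smul F G :
  polyvec F -> polyvec G -> polyvec (fun mu => smul mu (F mu) (G mu)).
Proof.
move=> pF pG k.
apply: (@polyfun_ext _ _ (fun mu => \sum_i \sum_j F mu i 0 * G mu j 0 * structure_const mu i j k)).
  by move=> mu; rewrite smulE.
apply: polyfun_sum => i; apply: polyfun_sum => j.
by apply: polyfunM; [exact: polyfunM | exact: polyfun_structure_const].
Qed.

Lemma closed_forall (T : topologicalType) (J : Type) (S : J -> set T) :
  (forall j, closed (S j)) -> closed [set x | forall j, S j x].
Proof.
move=> cS; rewrite (_ : [set _ | _] = \bigcap_j S j).
  by apply: closed_bigI => j _.
by apply/seteqP; split=> x /= H j //; exact: H.
Qed.

Lemma closed_imply (T : topologicalType) (P : Prop) (S : set T) :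
  closed S -> closed [set x | P -> S x].
Proof. by move=> cS; apply: closed_forall. Qed.

Lemma closed_polyvec_eq F G :
  polyvec F -> polyvec G -> closed [set mu | F mu = G mu].
Proof.
move=> pF pG.
rewrite (_ : [set _ | _] = [set mu | forall k, F mu k 0 - G mu k 0 = 0]).
  apply: closed_forall => k; apply: closed_eq0.
  exact: polyfunB (pF k) (pG k).
apply/seteqP; split=> mu /=.
  by move=> -> k; rewrite subrr.
by move=> H; apply/colP => k; apply/eqP; rewrite -subr_eq0 H.
Qed.

(** Each choice of parities and vectors gives a polynomial equation in the structure constants.
    Arbitrary intersections of closed sets are closed, so there is no reduction to basis vectors. *)
Lemma closed_jordan_superalgebras : closed (jordan_superalgebras K m n).
Proof.
apply: closedI.
- apply: closed_forall => a; apply: closed_forall => b.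
  apply: closed_forall => x; apply: closed_forall => y.
  do 2 apply: closed_imply.
  by apply: closed_polyvec_eq; [|apply: polyvecZ];
    apply: polyvec_smul; exact: polyvec_cst.
- apply: closed_forall => a; apply: closed_forall => b.
  apply: closed_forall => c; apply: closed_forall => d.
  apply: closed_forall => x; apply: closed_forall => y.
  apply: closed_forall => z; apply: closed_forall => t.
  do 4 apply: closed_imply.
  by apply: closed_polyvec_eq; repeat
    first [exact: polyvec_cst | apply: polyvecD | apply: polyvecZ | apply: polyvec_smul].
Qed.

End JordanClosed.

Section OrbitIrreducible.
Context (K : numFieldType) (m n : nat).

(** Two points of the orbit come from [g] and [h]. The segment from [g] to [h] stays in the group
    wherever its determinant is nonzero, and it moves [mu] along a rational curve inside the
    orbit. *)
Lemma irreducible_GL_orbit (mu : smult K m n) : irreducible (closure (GL_orbit mu)).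
Proof.
apply: irreducible_closure_curves; first by exists mu; exact: GL_orbit_refl.
move=> x y [g gg gE] [h hh hE].
have ug := graded_GL_unit gg; have uh := graded_GL_unit hh.
pose gt t := (1 - t) *: g + t *: h.
pose G : 'M[{poly K}]_(m + n) := map_mx polyC g + 'X *: map_mx polyC (h - g).
have GE t : map_mx (horner_eval t) G = gt t.
  by apply/matrixP => i j; rewrite !mxE /horner_eval !hornerE; ring.
have GtE t i j : (G i j).[t] = gt t i j by rewrite -GE [RHS]mxE.
have gt0 : gt 0 = g by rewrite /gt subr0 scale1r scale0r addr0.
have gt1 : gt 1 = h by rewrite /gt subrr scale1r scale0r add0r.
have dG t : (\det G).[t] = \det (gt t).
  by rewrite -GE det_map_mx.
have adjE t i j : (\adj G i j).[t] = \adj (gt t) i j.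
  by rewrite -GE -map_mx_adj [RHS]mxE.
have gtg t : \det (gt t) != 0 -> graded_GL (gt t).
  case: gg hh => [g0 [g1 [_ _ eg]]] [h0 [h1 [_ _ eh]]].
  have -> : gt t = block_mx ((1 - t) *: g0 + t *: h0) 0 0 ((1 - t) *: g1 + t *: h1).
    by rewrite /gt eg eh !scale_block_mx !scaler0 add_block_mx !addr0.
  rewrite det_ublock mulf_eq0 negb_or => /andP[d0 d1].
  by do 2 eexists; split; last reflexivity; rewrite unitmxE unitfE.
pose num (t : graded_triple m n) : {poly K} :=
  \sum_l \sum_a \sum_b G (val t).2 l *
    (\adj G a (val t).1.1 * \adj G b (val t).1.2 * (structure_const mu a b l)%:P).
(* The action uses the inverse twice, each time as adjugate over determinant: hence the squared
   determinant as denominator and two adjugates in [num]. *)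
exists (fun t => transport (gt t) mu); exists num; exists (\det G ^+ 2).
have tr t : graded_GL (gt t) -> GL_orbit mu (transport (gt t) mu).
  by move=> gG; exists (gt t) => // u v; rewrite smul_transport.
have dn0 t : (\det G ^+ 2).[t] != 0 -> \det (gt t) != 0.
  by rewrite horner_exp expf_eq0 /= dG.
split.
- move=> t /dn0 dt i; rewrite /affine_fun ffunE.
  have invE k : invmx (gt t) *m delta_mx k 0 =
      (\det (gt t))^-1 *: (\adj (gt t) *m delta_mx k 0 : 'cV_(m + n)).
    by rewrite /invmx unitmxE unitfE dt -scalemxAl.
  rewrite !invE smulZl smulZr -!scalemxAr scalerA [X in _ * X]mxE mulrA.
  have -> : (\det G ^+ 2).[t] * ((\det (gt t))^-1 * (\det (gt t))^-1) = 1.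
    by rewrite horner_exp dG; field.
  rewrite mul1r mxE /num horner_sum; apply: eq_bigr => l _.
  rewrite horner_sum smulE big_distrr; apply: eq_bigr => a _ /=.
  rewrite horner_sum big_distrr; apply: eq_bigr => b _ /=.
  by rewrite !hornerM hornerC !adjE GtE -!colE [col _ _ a 0]mxE [col _ _ b 0]mxE.
- by rewrite horner_exp dG gt0 expf_neq0// -unitfE -unitmxE.
- by rewrite horner_exp dG gt1 expf_neq0// -unitfE -unitmxE.
- split.
  + by rewrite gt0; apply: smul_inj => u v; rewrite smul_transport.
  + by rewrite gt1; apply: smul_inj => u v; rewrite smul_transport.
- by move=> t /dn0/gtg/tr.
Qed.

End OrbitIrreducible.

(** * One-dimensional even part *)

Section OneEvenDimension.
Context (K : fieldType) (n : nat).
Implicit Types (al a b : K) (A B : 'M[K]_n) (u v w x y z t : 'cV[K]_n).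

(** Column [j] of [A] is the product of [e] with the [j]-th odd basis vector, on either side because
    [e] is even. Skew-symmetry of [B] is not built in; it is what supercommutativity amounts to. *)
Definition mult1_const al A B (i j k : 'I_(1 + n)) : K :=
  match fintype.split i, fintype.split j, fintype.split k with
  | inl _, inl _, inl _ => al
  | inl _, inr j, inr k => A k j
  | inr i, inl _, inr k => A k i
  | inr i, inr j, inl _ => B i j
  | _, _, _ => 0
  end.

Definition mult1 al A B : smult K 1 n :=
  [ffun t : graded_triple 1 n => mult1_const al A B (val t).1.1 (val t).1.2 (val t).2].

Definition vec a u : 'cV[K]_(1 + n) := col_mx a%:M u.

Definition oddform B u v := (u^T *m B *m v) 0 0.

Lemma oddformDl B u v w : oddform B (u + v) w = oddform B u w + oddform B v w.
Proof. by rewrite /oddform linearD !mulmxDl mxE. Qed.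

Lemma oddformDr B u v w : oddform B u (v + w) = oddform B u v + oddform B u w.
Proof. by rewrite /oddform mulmxDr mxE. Qed.

Lemma oddformZl B a u v : oddform B (a *: u) v = a * oddform B u v.
Proof. by rewrite /oddform linearZ /= -!scalemxAl mxE. Qed.

Lemma oddformZr B a u v : oddform B u (a *: v) = a * oddform B u v.
Proof. by rewrite /oddform -scalemxAr mxE. Qed.

Lemma oddformE B u v : oddform B u v = \sum_i \sum_j u i 0 * v j 0 * B i j.
Proof.
rewrite /oddform mxE exchange_big; apply: eq_bigr => j _ /=.
rewrite mxE big_distrl; apply: eq_bigr => i _ /=.
by rewrite mxE mulrAC.
Qed.

Lemma oddform_delta B i j : oddform B (delta_mx i 0) (delta_mx j 0) = B i j.
Proof. by rewrite /oddform trmx_delta -rowE -colE !mxE. Qed.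

Lemma oddform_skew B u v : B^T = - B -> oddform B u v = - oddform B v u.
Proof.
move=> sB; rewrite /oddform -[in LHS](trmxK (_ *m v)) mxE !trmx_mul trmxK sB.
by rewrite mulNmx mulmxN mxE mulmxA.
Qed.

Lemma vecK (w : 'cV[K]_(1 + n)) : vec (w (lshift n 0) 0) (dsubmx w) = w.
Proof.
rewrite -[RHS]vsubmxK; congr col_mx.
by apply/colP => i; rewrite !mxE ord1 eqxx.
Qed.

Lemma split_lshift m1 m2 (i : 'I_m1) : fintype.split (lshift m2 i) = inl i.
Proof. by have := unsplitK (inl i : 'I_m1 + 'I_m2). Qed.

Lemma split_rshift m1 m2 (i : 'I_m2) : fintype.split (rshift m1 i) = inr i.
Proof. by have := unsplitK (inr i : 'I_m1 + 'I_m2). Qed.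

Lemma parity_lshift (i : 'I_1) : parity (lshift n i) = false.
Proof. by rewrite ord1. Qed.

Lemma parity_rshift i : @parity 1 n (rshift 1 i) = true.
Proof. by []. Qed.

Lemma structure_const_mult1 al A B i j k :
  structure_const (mult1 al A B) i j k = mult1_const al A B i j k.
Proof.
rewrite /structure_const; case: insubP => [t _ tE|].
  by rewrite /affine_fun ffunE tE.
by rewrite /mult1_const; case: split_ordP => i' ->; case: split_ordP => j' ->; case: split_ordP => k' ->;
  rewrite /= ?parity_lshift ?parity_rshift.
Qed.

(** From here on, products are computed with [al], [A] and the form of [B] instead of structure
    constants. *)
Lemma smul_mult1 al A B a u b v :
  smul (mult1 al A B) (vec a u) (vec b v) =
  vec (al * a * b + oddform B u v) (a *: (A *m v) + b *: (A *m u)).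
Proof.
apply/colP => k; rewrite smulE big_split_ord big_ord1 /= big_split_ord big_ord1 /=.
under [X in _ + X]eq_bigr => i _ do rewrite big_split_ord big_ord1 /=.
rewrite big_split /= /vec.
under eq_bigr => j _ do rewrite structure_const_mult1 /mult1_const split_lshift split_rshift.
under [X in _ + (X + _)]eq_bigr => j _ do rewrite structure_const_mult1 /mult1_const split_lshift split_rshift.
under [X in _ + (_ + X)]eq_bigr => i _ do under eq_bigr => j _ do rewrite structure_const_mult1 /mult1_const !split_rshift.
rewrite structure_const_mult1 /mult1_const !split_lshift /= !col_mxEu !mxE !eqxx !mulr1n.
case: (split_ordP k) => k' _.
  rewrite !mxE ord1 eqxx mulr1n.
  rewrite [X in _ + X + _]big1 ?addr0 => [|j _]; last by rewrite mulr0.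
  rewrite [X in _ + (X + _)]big1 ?add0r => [|j _]; last by rewrite mulr0.
  rewrite oddformE; congr (_ + _); first by ring.
  by apply: eq_bigr => i _; apply: eq_bigr => j _; rewrite !col_mxEd.
rewrite !mxE mulr0 add0r [X in _ + (_ + X)]big1 ?addr0; last first.
  by move=> i _; rewrite big1// => j _; rewrite mulr0.
by congr (_ + _); rewrite big_distrr; apply: eq_bigr => j _; rewrite !col_mxEd /= ?mxE ?eqxx ?mulr1n; ring.
Qed.

Lemma vec_inj a b u v : vec a u = vec b v -> a = b /\ u = v.
Proof.
by move=> /eq_col_mx[/matrixP/(_ 0 0)]; rewrite !mxE eqxx !mulr1n.
Qed.

End OneEvenDimension.

Section OneEvenDimensionJordan.
Context (K : fieldType) (n : nat).
Implicit Types (al a b : K) (A B : 'M[K]_n) (u v w x y z t : 'cV[K]_n).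

Lemma supercommutative_const m (mu : smult K m n) i j k : supercommutative mu ->
  structure_const mu i j k = (-1) ^+ (parity i && parity j) * structure_const mu j i k.
Proof.
move=> sc; rewrite -!smul_delta (sc (parity i) (parity j)) ?mxE//.
- exact: homogeneous_delta.
- exact: homogeneous_delta.
Qed.

Lemma supercommutative_mult1 (mu : smult K 1 n) : supercommutative mu ->
  exists al A B, B^T = - B /\ mu = mult1 al A B.
Proof.
move=> sc.
exists (structure_const mu (lshift n 0) (lshift n 0) (lshift n 0)).
exists (\matrix_(k, j) structure_const mu (lshift n 0) (rshift 1 j) (rshift 1 k)).
exists (\matrix_(i, j) structure_const mu (rshift 1 i) (rshift 1 j) (lshift n 0)).
split.
  apply/matrixP => i j; rewrite !mxE (supercommutative_const _ _ _ sc).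
  by rewrite !parity_rshift expr1 mulN1r.
apply: smult_eqP => i j k; rewrite structure_const_mult1 /mult1_const.
case: (split_ordP i) => i' ->; case: (split_ordP j) => j' ->;
  case: (split_ordP k) => k' ->; rewrite ?mxE ?ord1 //.
all: try by rewrite structure_const_odd // ?parity_lshift ?parity_rshift.
rewrite (supercommutative_const _ _ _ sc) parity_lshift parity_rshift.
by rewrite expr0 mul1r.
Qed.

(** After [jd_skew], the fields are the Jordan identity at the quadruples (e, e, e, u), (e, e, u,
    v), (u, e, e, v), (x, y, e, t), (x, y, z, e) and (x, y, z, t), in this order. The right side of
    the last is [al] times a polarised Pfaffian. *)
Record jordan_datum al A B : Prop := JordanDatum {
  jd_skew : B^T = - B;
  jd_cubic : forall u, 2%:R *: (A *m (A *m (A *m u))) + al ^+ 2 *: (A *m u)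
    = (3%:R * al) *: (A *m (A *m u));
  jd_form_eval : forall u v, al * oddform B (A *m u) v + 2%:R * al * oddform B u (A *m v)
    = al ^+ 2 * oddform B u v + 2%:R * oddform B (A *m u) (A *m v);
  jd_form_square : forall u v, oddform B (A *m (A *m u)) v + oddform B u (A *m (A *m v))
    = 2%:R * oddform B (A *m u) (A *m v);
  jd_cyclic : forall x y t,
    oddform B x y *: (A *m (A *m t)) - oddform B x t *: (A *m (A *m y))
      + oddform B y t *: (A *m (A *m x))
    = al *: (oddform B x y *: (A *m t) - oddform B x t *: (A *m y) + oddform B y t *: (A *m x));
  jd_exchange : forall x y z,
    oddform B (A *m y) z *: (A *m x) - oddform B (A *m x) z *: (A *m y)
    = oddform B y z *: (A *m (A *m x)) - oddform B x z *: (A *m (A *m y));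
  jd_pfaffian : forall x y z t,
    oddform B x y * oddform B (A *m z) t - oddform B x t * oddform B (A *m z) y
      + oddform B y t * oddform B (A *m z) x
    = al * (oddform B x y * oddform B z t + oddform B x t * oddform B y z - oddform B x z * oddform B y t) }.

Lemma homogeneous_vecP p (w : 'cV[K]_(1 + n)) : homogeneous p w <->
  if p then exists u, w = vec 0 u else exists a, w = vec a 0.
Proof.
rewrite -(vecK w) /homogeneous; case: p.
  rewrite col_mxKu; split=> [/matrixP/(_ 0 0)|[u /vec_inj[-> _]]]; last exact: raddf0.
  by rewrite !mxE eqxx !mulr1n => ->; eexists.
by rewrite col_mxKd; split=> [->|[a /vec_inj[_ ->]]]; first by eexists.
Qed.

Lemma homogeneous_even a : homogeneous false (vec a 0 : 'cV[K]_(1 + n)).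
Proof. by apply/homogeneous_vecP; exists a. Qed.

Lemma homogeneous_odd u : homogeneous true (vec 0 u).
Proof. by apply/homogeneous_vecP; exists u. Qed.

Lemma oddform0l B u : oddform B 0 u = 0.
Proof. by have := oddformZl B 0 0 u; rewrite scale0r mul0r. Qed.

Lemma oddform0r B u : oddform B u 0 = 0.
Proof. by have := oddformZr B 0 u 0; rewrite scale0r mul0r. Qed.

Lemma vecD a u b v : vec a u + vec b v = vec (a + b) (u + v).
Proof. by rewrite /vec add_col_mx raddfD. Qed.

Lemma vecZ c a u : c *: vec a u = vec (c * a) (c *: u).
Proof. by rewrite /vec scale_col_mx scale_scalar_mx. Qed.

Definition smul_vecE := (smul_mult1, oddform0l, oddform0r, mulmx0, scaler0, scale0r,
  mulr0, mul0r, addr0, add0r).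

Lemma supercommutative_mult1P al A B :
  supercommutative (mult1 al A B) <-> B^T = - B.
Proof.
split=> [sc|sB].
  apply/matrixP => i j; rewrite !mxE.
  have := supercommutative_const (rshift 1 j) (rshift 1 i) (lshift n 0) sc.
  rewrite !structure_const_mult1 /mult1_const !split_rshift split_lshift.
  by rewrite !parity_rshift expr1 mulN1r.
move=> a b x y /homogeneous_vecP hx /homogeneous_vecP hy.
case: a b hx hy => -[] /= [u ->] [v ->]; rewrite ?expr0 ?expr1 ?scaleN1r ?scale1r;
  rewrite !smul_vecE //; last by rewrite mulrAC.
by rewrite (oddform_skew _ _ sB) -[RHS]scaleN1r vecZ scaler0 mulN1r.
Qed.

(** Proof by linear combination: the goal is [c] times a known equation, which [ring] or [field]
    then checks. The constants [c] below are these multipliers. *)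
Lemma lincomb (c a b x y : K) : a = b -> x - y = c * (a - b) -> x = y.
Proof. by move=> -> /eqP; rewrite subrr mulr0 subr_eq0 => /eqP. Qed.

Lemma colDE u v k : (u + v) k 0 = u k 0 + v k 0. Proof. by rewrite mxE. Qed.
Lemma colNE u k : (- u) k 0 = - u k 0. Proof. by rewrite mxE. Qed.
Lemma colZE a u k : (a *: u) k 0 = a * u k 0. Proof. by rewrite mxE. Qed.

(** Each of the sixteen parity patterns is a multiple of one field, with the coefficients of the
    even arguments as multiplier; [sk] reorders the arguments of the form. The two patterns closed
    by bare [ring] have no odd vector except possibly [z]. *)
Lemma jordan_mult1 al A B : jordan_datum al A B ->
  jordan_superalgebras K 1 n (mult1 al A B).
Proof.
move=> [sB cub fe fs cyc exch pf]; split; first exact/supercommutative_mult1P.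
have sk u v := oddform_skew u v sB.
move=> a b c d x y z t /homogeneous_vecP hx /homogeneous_vecP hy /homogeneous_vecP hz
  /homogeneous_vecP ht.
case: a b c d hx hy hz ht => -[] [] [] /= [x' ->] [y' ->] [z' ->] [t' ->] {x y z t};
 rewrite ?(muln1, mul1n, muln0, mul0n, addn0, add0n) /= ?[(-1) ^+ _]expr0 ?expr1 ?sqrrN ?expr1n;
 rewrite !smul_vecE.
all: rewrite ?vecZ ?vecD ?scaler0 ?mulr0 ?addr0 -?scalemxAr ?oddformZl ?oddformZr;
  congr vec => //; try (apply/colP => k; rewrite !(colDE, colNE, colZE)).
- by apply: (lincomb (pf x' y' z' t') (c := 1)); ring.
- have /colP/(_ k) := exch x' y' z'; rewrite !(colDE, colNE, colZE) => H.
  by apply: (lincomb H (c := t')); ring.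
- have /colP/(_ k) := cyc x' y' t'; rewrite !(colDE, colNE, colZE) => H.
  by apply: (lincomb H (c := - z')); ring.
- apply: (lincomb (fs x' y') (c := z' * t')).
  by ring: (sk (A *m (A *m y')) x').
- have /colP/(_ k) := exch t' x' z'; rewrite !(colDE, colNE, colZE) => H.
  by apply: (lincomb H (c := y')); ring: (sk t' z').
- apply: (lincomb (fe z' x') (c := - y' * t')).
  by ring: (sk (A *m z') x') (sk z' x') (sk z' (A *m x')) (sk (A *m z') (A *m x')).
- apply: (lincomb (fs x' t') (c := z' * y')).
  by ring: (sk (A *m (A *m t')) x').
- have /colP/(_ k) := cub x'; rewrite !(colDE, colNE, colZE) => H.
  by apply: (lincomb H (c := t' * z' * y')); ring.
- have /colP/(_ k) := exch t' y' z'; rewrite !(colDE, colNE, colZE) => H.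
  by apply: (lincomb H (c := x')); ring: (sk t' z').
- apply: (lincomb (fe z' y') (c := - x' * t')).
  by ring: (sk (A *m z') y') (sk z' y') (sk z' (A *m y')) (sk (A *m z') (A *m y')).
- apply: (lincomb (fs y' t') (c := z' * x')).
  by ring: (sk (A *m (A *m t')) y') (sk (A *m t') (A *m y')).
- have /colP/(_ k) := cub y'; rewrite !(colDE, colNE, colZE) => H.
  by apply: (lincomb H (c := t' * z' * x')); ring.
- apply: (lincomb (fe z' t') (c := x' * y')).
  by ring: (sk (A *m t') z') (sk (A *m t') (A *m z')).
- by ring.
- have /colP/(_ k) := cub t'; rewrite !(colDE, colNE, colZE) => H.
  by apply: (lincomb H (c := x' * z' * y')); ring.
- by ring.
Qed.

Lemma jordan_mult1_datum al A B :
  jordan_superalgebras K 1 n (mult1 al A B) -> jordan_datum al A B.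
Proof.
move=> [/supercommutative_mult1P sB ji].
have sk u v := oddform_skew u v sB.
have E a := homogeneous_even a; have O u := homogeneous_odd u.
split=> //.
- move=> u; have := ji _ _ _ _ _ _ _ _ (E 1) (E 1) (E 1) (O u).
  rewrite ?(muln1, mul1n, muln0, mul0n, addn0, add0n) !smul_vecE ?vecZ ?vecD -?scalemxAr.
  move=> /vec_inj[_ /colP H]; apply/colP => k; move: (H k).
  rewrite !(colDE, colNE, colZE) => {}H.
  by apply: (lincomb H (c := 1)); ring.
- move=> u v; have := ji _ _ _ _ _ _ _ _ (E 1) (E 1) (O u) (O v).
  rewrite ?(muln1, mul1n, muln0, mul0n, addn0, add0n) !smul_vecE ?vecZ ?vecD -?scalemxAr ?oddformZl ?oddformZr.
  move=> /vec_inj[H _]; apply: (lincomb H (c := 1)).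
  by ring: (sk (A *m v) u) (sk (A *m v) (A *m u)).
- move=> u v; have := ji _ _ _ _ _ _ _ _ (O u) (E 1) (E 1) (O v).
  rewrite ?(muln1, mul1n, muln0, mul0n, addn0, add0n) !smul_vecE ?vecZ ?vecD -?scalemxAr ?oddformZl ?oddformZr.
  move=> /vec_inj[H _]; apply: (lincomb H (c := 1)).
  by ring: (sk (A *m (A *m v)) u).
- move=> x y t; have := ji _ _ _ _ _ _ _ _ (O x) (O y) (E 1) (O t).
  rewrite ?(muln1, mul1n, muln0, mul0n, addn0, add0n) !smul_vecE ?vecZ ?vecD -?scalemxAr ?oddformZl ?oddformZr.
  move=> /vec_inj[_ /colP H]; apply/colP => k; move: (H k).
  rewrite !(colDE, colNE, colZE) => {}H.
  by apply: (lincomb H (c := -1)); ring.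
- move=> x y z; have := ji _ _ _ _ _ _ _ _ (O x) (O y) (O z) (E 1).
  rewrite ?(muln1, mul1n, muln0, mul0n, addn0, add0n) !smul_vecE ?vecZ ?vecD -?scalemxAr ?oddformZl ?oddformZr.
  move=> /vec_inj[_ /colP H]; apply/colP => k; move: (H k).
  rewrite !(colDE, colNE, colZE) => {}H.
  by apply: (lincomb H (c := 1)); ring.
- move=> x y z t; have := ji _ _ _ _ _ _ _ _ (O x) (O y) (O z) (O t).
  rewrite ?(muln1, mul1n, muln0, mul0n, addn0, add0n) !smul_vecE ?vecZ ?vecD -?scalemxAr ?oddformZl ?oddformZr.
  by move=> /vec_inj[H _]; apply: (lincomb H (c := 1)); ring.
Qed.

Lemma eq_mulmx_col (M N : 'M[K]_n) : (forall u, M *m u = N *m u) -> M = N.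
Proof.
move=> E; apply/matrixP => i j.
by have /colP/(_ i) := E (delta_mx j 0); rewrite -!colE !mxE.
Qed.

Lemma oddform_congr (P : 'M[K]_n) B u v : oddform (P^T *m B *m P) u v = oddform B (P *m u) (P *m v).
Proof. by rewrite /oddform trmx_mul !mulmxA. Qed.

Lemma oddform_ext B B' : (forall u v, oddform B u v = oddform B' u v) -> B = B'.
Proof. by move=> E; apply/matrixP => i j; rewrite -!oddform_delta. Qed.

Lemma oddform_scale c B u v : oddform (c *: B) u v = c * oddform B u v.
Proof. by rewrite /oddform -scalemxAr -scalemxAl mxE. Qed.

(** A graded automorphism is a scalar [s] on [e] and a matrix [P] on the odd part. It acts on [A] by
    conjugation and division by [s], and on [B] by congruence and multiplication by [s]. *)
Lemma GL_orbit_mult1 al0 A0 B0 al A B :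
  GL_orbit (mult1 al0 A0 B0) (mult1 al A B) <->
  exists s (P : 'M[K]_n), [/\ s != 0, P \in unitmx, al * s = al0,
    s *: (A *m P) = P *m A0 & P^T *m B *m P = s *: B0].
Proof.
have gE s (P : 'M[K]_n) a u : block_mx s%:M 0 0 P *m vec a u = vec (s * a) (P *m u).
  by rewrite /vec mul_block_col !mul0mx add0r addr0 -scalar_mxM.
split=> [/GL_orbitP[g [g0 [P [u0 uP ->]]] H]|[s [P [s0 uP als sAP PBP]]]].
  rewrite (mx11_scalar g0) in u0 H; set s := g0 0 0 in u0 H.
  have s0 : s != 0 by move: u0; rewrite unitmxE det_scalar1 unitfE.
  exists s; exists P; split=> //.
  - have := H (vec 1 0) (vec 1 0); rewrite !gE !smul_vecE gE => /vec_inj[+ _].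
    by rewrite !mulr1 [al * s]mulrC -mulrA => /(mulfI s0); rewrite mulrC.
  - apply: eq_mulmx_col => u.
    have := H (vec 1 0) (vec 0 u); rewrite !gE !smul_vecE gE => /vec_inj[_].
    by rewrite mulr1 !scale1r -scalemxAl !mulmxA.
  - apply: oddform_ext => u v; rewrite oddform_congr oddform_scale.
    have := H (vec 0 u) (vec 0 v); rewrite !gE !smul_vecE gE => /vec_inj[-> _] //.
apply/GL_orbitP; exists (block_mx s%:M 0 0 P).
  by exists s%:M; exists P; rewrite unitmxE det_scalar1 unitfE.
move=> x y; rewrite -(vecK x) -(vecK y).
set a := x _ _; set u := dsubmx x; set b := y _ _; set v := dsubmx y.
rewrite !gE !smul_mult1 gE -oddform_congr PBP oddform_scale -als; congr vec; first by ring.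
rewrite mulmxDr -!scalemxAr !mulmxA -sAP -!scalemxAl !scalerA.
by congr (_ + _); rewrite mulrC.
Qed.

End OneEvenDimensionJordan.

(** * Type (1,3): multiplications with an idempotent *)

Section TypeOneThree.
Context (K : numFieldType).
Implicit Types (al a b c : K) (A B P : 'M[K]_3) (u v w x y z : 'cV[K]_3).

Definition i0 : 'I_3 := @Ordinal 3 0 isT.
Definition i1 : 'I_3 := @Ordinal 3 1 isT.
Definition i2 : 'I_3 := @Ordinal 3 2 isT.

Lemma ord3P (i : 'I_3) : [\/ i = i0, i = i1 | i = i2].
Proof.
case: i => -[|[|[|//]]] Hi; [constructor 1|constructor 2|constructor 3]; exact: val_inj.
Qed.

Lemma forall_ord3 (Q : 'I_3 -> Prop) : Q i0 -> Q i1 -> Q i2 -> forall i, Q i.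
Proof. by move=> Q0 Q1 Q2 i; case: (ord3P i) => ->. Qed.

Lemma sum3E (V : nmodType) (F : 'I_3 -> V) : \sum_i F i = F i0 + F i1 + F i2.
Proof.
by rewrite !big_ord_recr big_ord0 /= add0r; congr (F _ + F _ + F _); exact: val_inj.
Qed.

Definition col3 a b c : 'cV[K]_3 := \col_i nth 0 [:: a; b; c] i.
Definition diag3 a b c : 'M[K]_3 := diag_mx (\row_i nth 0 [:: a; b; c] i).

(* The alternating form [u, v |-> det (w, u, v)], whose radical contains [w]. *)
Definition skew3 w : 'M[K]_3 :=
  \matrix_(i, j) nth 0 (nth [::] [:: [:: 0; w i2 0; - w i1 0];
                                   [:: - w i2 0; 0; w i0 0];
                                   [:: w i1 0; - w i0 0; 0]] i) j.

(** The sum of [of_table] without the subtype of graded triples, so that it evaluates at concrete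
    indices. *)
Definition table_const (s : seq ('I_(1 + 3) * 'I_(1 + 3) * 'I_(1 + 3) * K)) (i j k : 'I_(1 + 3)) : K :=
  \sum_(r <- s)
    let: (i', j', k', a) := r in
    if (i, j, k) == (i', j', k') then a
    else if (i, j, k) == (j', i', k') then (-1) ^+ (parity i' && parity j') * a
    else 0.

Lemma structure_const_of_table s i j k :
  parity k == parity i (+) parity j :> bool ->
  structure_const (of_table s) i j k = table_const s i j k.
Proof.
move=> kij; rewrite /structure_const; case: insubP => [t _ tE|/=]; last by rewrite kij.
by rewrite /affine_fun ffunE /table_const -tE.
Qed.

Lemma of_table_mult1 s al A B :
  let e : 'I_(1 + 3) := lshift 3 ord0 in let f := @rshift 1 3 in
  table_const s e e e = al ->
  (forall j k, table_const s e (f j) (f k) = A k j) ->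
  (forall i k, table_const s (f i) e (f k) = A k i) ->
  (forall i j, table_const s (f i) (f j) e = B i j) ->
  of_table s = mult1 al A B.
Proof.
move=> /= E1 E2 E3 E4; apply: smult_eqP => i j k.
rewrite structure_const_mult1 /mult1_const.
case: (split_ordP i) => i' ->; case: (split_ordP j) => j' ->;
  case: (split_ordP k) => k' ->; rewrite ?ord1.
all: try by rewrite structure_const_odd // ?parity_lshift ?parity_rshift.
all: by rewrite structure_const_of_table// ?parity_lshift ?parity_rshift.
Qed.

Local Ltac table_mult1 :=
  apply: of_table_mult1; rewrite /table_const;
    [ by rewrite !big_cons big_nil /= ?addr0
    | by do 2 elim/forall_ord3; rewrite !big_cons big_nil !mxE /= ?addr0 ?add0r
    | by do 2 elim/forall_ord3; rewrite !big_cons big_nil !mxE /= ?expr0 ?mul1r ?addr0 ?add0r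
    | by do 2 elim/forall_ord3; rewrite ?big_cons big_nil !mxE /= ?expr1 ?mulN1r ?oppr0 ?addr0 ?add0r ].

(** The radical of the form is spanned by [f1], which [e] sends to [f2], outside the radical. *)
Lemma J5E : J5 K = mult1 0 (delta_mx i1 i0) (skew3 (col3 1 0 0)).
Proof. table_mult1. Qed.

Definition idempotent_mult a b c w := mult1 1 (diag3 a b c) (skew3 w).

Lemma J7E : J7 K = idempotent_mult 0 0 0 0. Proof. table_mult1. Qed.
Lemma J8E : J8 K = idempotent_mult 0 0 2^-1 0. Proof. table_mult1. Qed.
Lemma J9E : J9 K = idempotent_mult 0 0 1 0. Proof. table_mult1. Qed.
Lemma J11E : J11 K = idempotent_mult 0 2^-1 2^-1 (col3 1 0 0). Proof. table_mult1. Qed.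
Lemma J12E : J12 K = idempotent_mult 0 2^-1 1 0. Proof. table_mult1. Qed.
Lemma J14E : J14 K = idempotent_mult 0 1 1 (col3 1 0 0). Proof. table_mult1. Qed.
Lemma J15E : J15 K = idempotent_mult 2^-1 2^-1 2^-1 0. Proof. table_mult1. Qed.
Lemma J16E : J16 K = idempotent_mult 2^-1 2^-1 1 0. Proof. table_mult1. Qed.
Lemma J17E : J17 K = idempotent_mult 2^-1 1 1 0. Proof. table_mult1. Qed.
Lemma J19E : J19 K = idempotent_mult 1 1 1 (col3 0 0 1). Proof. table_mult1. Qed.

(* In each row [4 tr A^2 = N], which tells the spectra apart. [NF10], [NF13] and
   [NF18] are limits of [NF11], [NF14] and [NF19]. *)
Inductive normal_form : nat -> K -> K -> K -> 'cV[K]_3 -> Prop :=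
| NF7 : normal_form 0 0 0 0 0
| NF8 : normal_form 1 0 0 2^-1 0
| NF9 : normal_form 4 0 0 1 0
| NF10 : normal_form 2 0 2^-1 2^-1 0
| NF11 : normal_form 2 0 2^-1 2^-1 (col3 1 0 0)
| NF12 : normal_form 5 0 2^-1 1 0
| NF13 : normal_form 8 0 1 1 0
| NF14 : normal_form 8 0 1 1 (col3 1 0 0)
| NF15 : normal_form 3 2^-1 2^-1 2^-1 0
| NF16 : normal_form 6 2^-1 2^-1 1 0
| NF17 : normal_form 9 2^-1 1 1 0
| NF18 : normal_form 12 1 1 1 0
| NF19 : normal_form 12 1 1 1 (col3 0 0 1).

End TypeOneThree.

Section TypeOneThreeJordan.
Context (K : numFieldType).
Implicit Types (al a b c : K) (A B P : 'M[K]_3) (u v w x y z : 'cV[K]_3).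

Lemma diag3_mulE a b c u : diag3 a b c *m u = col3 (a * u i0 0) (b * u i1 0) (c * u i2 0).
Proof.
by apply/colP; elim/forall_ord3; rewrite /diag3 mul_diag_mx !mxE.
Qed.

Lemma col3_i0 a b c : col3 a b c i0 0 = a. Proof. by rewrite mxE. Qed.
Lemma col3_i1 a b c : col3 a b c i1 0 = b. Proof. by rewrite mxE. Qed.
Lemma col3_i2 a b c : col3 a b c i2 0 = c. Proof. by rewrite mxE. Qed.
Definition col3E := (col3_i0, col3_i1, col3_i2).

Lemma oddform_skew3 w u v : oddform (skew3 w) u v =
  w i0 0 * (u i1 0 * v i2 0 - u i2 0 * v i1 0)
  + w i1 0 * (u i2 0 * v i0 0 - u i0 0 * v i2 0)
  + w i2 0 * (u i0 0 * v i1 0 - u i1 0 * v i0 0).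
Proof. by rewrite oddformE !sum3E !mxE /=; ring. Qed.

Lemma skew3_tr w : (skew3 w)^T = - skew3 w.
Proof. by apply/matrixP; do 2 elim/forall_ord3; rewrite !mxE /= ?opprK ?oppr0. Qed.

(** Special to dimension three, where alternating forms correspond to vectors. The diagonal vanishes
    because 2 is invertible. *)
Lemma skew3_surj B : B^T = - B -> exists w, B = skew3 w.
Proof.
move=> /matrixP sB; have E i j : B j i = - B i j by have := sB i j; rewrite !mxE.
have Z i : B i i = 0.
  by have /eqP := E i i; rewrite -addr_eq0 -mulr2n -mulr_natl mulf_eq0 pnatr_eq0 => /eqP.
exists (col3 (B i1 i2) (B i2 i0) (B i0 i1)).
by apply/matrixP; do 2 elim/forall_ord3; rewrite !mxE /= ?Z ?opprK // E.
Qed.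

Lemma skew3_0 : skew3 (0 : 'cV[K]_3) = 0.
Proof. by apply/matrixP; do 2 elim/forall_ord3; rewrite !mxE /= ?oppr0. Qed.

Lemma skew3Z a w : skew3 (a *: w) = a *: skew3 w.
Proof. by apply/matrixP; do 2 elim/forall_ord3; rewrite !mxE /= ?mulr0 ?mulrN. Qed.

Lemma oddform_0 u v : oddform (0 : 'M[K]_3) u v = 0.
Proof. by rewrite /oddform mulmx0 mul0mx mxE. Qed.

Lemma jordan_datum_form0 al A :
  (forall u, 2%:R *: (A *m (A *m (A *m u))) + al ^+ 2 *: (A *m u)
    = (3%:R * al) *: (A *m (A *m u))) ->
  jordan_datum al A 0.
Proof.
by move=> cub; split=> // *;
  rewrite ?(trmx0, oddform_0, scale0r, subrr, scaler0, mulr0, oppr0, addr0, mul0r).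
Qed.

Lemma normal_form_jordan N a b c w : normal_form N a b c w ->
  jordan_superalgebras K 1 3 (idempotent_mult a b c w).
Proof.
move=> nf; apply: jordan_mult1.
case: nf => {a b c w}; rewrite ?skew3_0.
(* The ten normal forms with [w = 0], for which only the cubic equation remains. *)
1-4,6-7,9-12: apply: jordan_datum_form0 => u; rewrite !diag3_mulE !col3E;
  by apply/colP; elim/forall_ord3; rewrite !(colDE, colNE, colZE) !col3E; field.
all: split; first exact: skew3_tr.
all: move=> *; rewrite ?oddform_skew3 !diag3_mulE ?oddform_skew3 !col3E ?oddform_skew3 ?col3E.
all: try by field.
all: by apply/colP; elim/forall_ord3; rewrite !(colDE, colNE, colZE) !col3E; field.
Qed.

Lemma J5_jordan : jordan_superalgebras K 1 3 (J5 K).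
Proof.
rewrite J5E; apply: jordan_mult1.
have dE u : (delta_mx i1 i0 : 'M[K]_3) *m u = col3 0 (u i0 0) 0.
  by apply/colP; elim/forall_ord3; rewrite !mxE sum3E !mxE /=; ring.
split; first exact: skew3_tr.
all: move=> *; rewrite ?oddform_skew3 !dE ?oddform_skew3 !col3E ?oddform_skew3 ?col3E.
all: try by ring.
all: by apply/colP; elim/forall_ord3; rewrite !(colDE, colNE, colZE) !col3E; ring.
Qed.

End TypeOneThreeJordan.

(** * Classification when [e^2] is nonzero *)

Section IdempotentClassification.
Context (K : numFieldType).
Implicit Types (al a b c : K) (A B P : 'M[K]_3) (u v w x y z : 'cV[K]_3).

Lemma mulmx1_unitl (P Q : 'M[K]_3) : P *m Q = 1%:M -> P \in unitmx.
Proof. by case/mulmx1_unit. Qed.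

Lemma unitmx_ker n (P : 'M[K]_n) : (forall u : 'cV_n, P *m u = 0 -> u = 0) -> P \in unitmx.
Proof.
move=> inj; rewrite -unitmx_tr -row_free_unit; apply/inj_row_free => v.
move=> /(congr1 trmx); rewrite trmx_mul trmxK trmx0 => /inj /(congr1 trmx).
by rewrite trmxK trmx0.
Qed.

(** The hypothesis is annihilation by 2X(X - 1/2)(X - 1). Its roots are distinct, so the minimal
    polynomial is a product of distinct linear factors. *)
Lemma root_cubic_diagonalizable n (A : 'M[K]_n.+1) :
  2%:R *: (A *m (A *m A)) + A = 3%:R *: (A *m A) ->
  exists (P : 'M[K]_n.+1) d, [/\ P \in unitmx, A *m P = P *m diag_mx d &
    forall i, d 0 i \in [:: 0; 2^-1; 1]].
Proof.
move=> cub.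
have [Q uQ [d /(simmxP uQ) Ad]] : exists2 Q, Q \in unitmx & exists d, A ~_Q (diag_mx d).
  have [] : diagonalizable A.
    apply/diagonalizableP; exists [:: 0; 2^-1; 1].
      rewrite /= !inE !negb_or andbT eq_sym invr_eq0 pnatr_eq0 /= eq_sym oner_eq0 /=.
      by rewrite invr_eq1 (eqr_nat _ 2 1).
    apply: mxminpoly_min.
    rewrite !big_cons big_nil mulr1 !rmorphM !rmorphB /= horner_mx_X !horner_mx_C.
    have -> : (0%:M : 'M[K]_n.+1) = 0 by rewrite raddf0.
    rewrite subr0 mulrBl !mulrBr mulr1.
    rewrite -!mulmxE mul_mx_scalar mul_scalar_mx scale1r -scalemxAr mul_mx_scalar.
    move: (A *m (A *m A)) (A *m A) cub => X Y cub.
    apply/matrixP => i j; have /matrixP/(_ i j) := cub; rewrite !mxE => H.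
    by apply: (lincomb H (c := 2^-1)); field.
  by move=> Q uQ /diagonalizable_forPex dQ; exists Q.
have APE : A *m invmx Q = invmx Q *m diag_mx d.
  by rewrite -[LHS](mulKmx uQ) [Q *m _]mulmxA Ad mulmxK.
exists (invmx Q); exists d; rewrite unitmx_inv; split=> // i.
have uV : invmx Q \in unitmx by rewrite unitmx_inv.
have A2 : A *m A *m invmx Q = invmx Q *m (diag_mx d *m diag_mx d).
  by rewrite -[LHS]mulmxA APE mulmxA APE -mulmxA.
have A3 : A *m (A *m A) *m invmx Q = invmx Q *m (diag_mx d *m (diag_mx d *m diag_mx d)).
  by rewrite -[LHS]mulmxA A2 [A *m (_ *m _)]mulmxA APE -mulmxA.
(* The diagonal entries are roots too: the conjugated equation is read at position [(i, i)]. *)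
have := congr1 (fun M => (Q *m (M *m invmx Q)) i i) cub.
rewrite mulmxDl -!scalemxAl A3 A2 APE mulmxDr -!scalemxAr !mulKVmx//.
rewrite !mulmx_diag !mxE eqxx !mulr1n => H.
have : d 0 i * ((2 * d 0 i - 1) * (d 0 i - 1)) = 0.
  by apply: (lincomb H (c := 1)); ring.
rewrite !inE => /eqP; rewrite !mulf_eq0 => /or3P[->//|/eqP H2|].
  apply/orP; right; apply/orP; left; apply/eqP.
  by apply: (lincomb H2 (c := 2^-1)); field.
by rewrite subr_eq0 => ->; rewrite !orbT.
Qed.

Lemma jordan_diagonalize al A B : al != 0 -> jordan_superalgebras K 1 3 (mult1 al A B) ->
  exists a b c w, [/\ a \in [:: 0; 2^-1; 1], b \in [:: 0; 2^-1; 1],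
    c \in [:: 0; 2^-1; 1] & GL_orbit (idempotent_mult a b c w) (mult1 al A B)].
Proof.
move=> al0 /jordan_mult1_datum jd.
have [|P [d [uP AP dP]]] := @root_cubic_diagonalizable 2 (al^-1 *: A).
  apply: eq_mulmx_col => u; have /(congr1 (fun v => al^-1 ^+ 3 *: v)) := jd_cubic jd u.
  rewrite mulmxDl -!(scalemxAl, scalemxAr) -!mulmxA !(scalerDr, scalerA) => /colP H.
  apply/colP => k; move: (H k); rewrite !(colDE, colZE) => {}H.
  by apply: (lincomb H (c := 1)); field.
have [|w wE] := @skew3_surj _ (al *: (P^T *m B *m P)).
  by rewrite linearZ /= !trmx_mul trmxK (jd_skew jd) !mulNmx mulmxN mulmxA scalerN.
exists (d 0 i0), (d 0 i1), (d 0 i2), w; split=> //.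
(* The vector [al^-1 e] is idempotent. This forces [s = al^-1], and the factor [al] in front of the
   form above compensates for it. *)
apply/GL_orbit_mult1; exists al^-1; exists P; split=> //.
- by rewrite invr_eq0.
- by rewrite divff.
- rewrite scalemxAl AP; congr (_ *m diag_mx _).
  by apply/rowP; elim/forall_ord3; rewrite !mxE.
- by rewrite -wE scalerA mulVf// scale1r.
Qed.

Lemma GL_orbit_idempotent_mult P a b c a' b' c' w :
  P \in unitmx -> diag3 a b c *m P = P *m diag3 a' b' c' ->
  exists w', GL_orbit (idempotent_mult a' b' c' w') (idempotent_mult a b c w).
Proof.
move=> uP E; have [|w' wE] := @skew3_surj _ (P^T *m skew3 w *m P).
  by rewrite !trmx_mul trmxK skew3_tr mulNmx mulmxN mulmxA.
exists w'; apply/GL_orbit_mult1; exists 1; exists P.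
by rewrite oner_eq0 mulr1 !scale1r.
Qed.

Definition has_normal_form (mu : smult K 1 3) :=
  exists N a b c w, normal_form N a b c w /\ GL_orbit (idempotent_mult a b c w) mu.

(** Quantifying over [w] makes the property invariant under permutations of the odd basis, which
    change [w]. *)
Definition diag_classified a b c := forall w,
  jordan_superalgebras K 1 3 (idempotent_mult a b c w) -> has_normal_form (idempotent_mult a b c w).

Lemma diag_classified_conj P a b c a' b' c' :
  P \in unitmx -> diag3 a b c *m P = P *m diag3 a' b' c' ->
  diag_classified a' b' c' -> diag_classified a b c.
Proof.
move=> uP E cl w jw; have [w' ww'] := GL_orbit_idempotent_mult w uP E.
have [N [x [y [z [v [nf H]]]]]] := cl w' (jordan_GL_orbit (GL_orbit_sym ww') jw).
by exists N, x, y, z, v; split=> //; exact: GL_orbit_trans ww'.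
Qed.

Definition mx3 (rows : seq (seq K)) : 'M[K]_3 := \matrix_(i, j) nth 0 (nth [::] rows i) j.

Lemma diag_classified_swap01 a b c : diag_classified b a c -> diag_classified a b c.
Proof.
pose P := mx3 [:: [:: 0; 1; 0]; [:: 1; 0; 0]; [:: 0; 0; 1]].
apply: (@diag_classified_conj P).
  apply: (@mulmx1_unitl _ P).
  by apply/matrixP; do 2 elim/forall_ord3; rewrite !mxE !sum3E !mxE /=; ring.
by apply/matrixP; do 2 elim/forall_ord3; rewrite !mxE !sum3E !mxE /=; ring.
Qed.

Lemma diag_classified_swap12 a b c : diag_classified a c b -> diag_classified a b c.
Proof.
pose P := mx3 [:: [:: 1; 0; 0]; [:: 0; 0; 1]; [:: 0; 1; 0]].
apply: (@diag_classified_conj P).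
  apply: (@mulmx1_unitl _ P).
  by apply/matrixP; do 2 elim/forall_ord3; rewrite !mxE !sum3E !mxE /=; ring.
by apply/matrixP; do 2 elim/forall_ord3; rewrite !mxE !sum3E !mxE /=; ring.
Qed.

(** The third column of [P] is the radical vector [w]; the other two are basis vectors, one of them
    rescaled so that [det P = 1]. As the form is a determinant with [w] in the first slot, its new
    radical vector is the third basis vector. *)
Lemma skew_radical_normal w : w != 0 ->
  exists2 P : 'M[K]_3, P \in unitmx & P^T *m skew3 w *m P = skew3 (col3 0 0 1).
Proof.
move=> w0.
have [k wk] : exists k, w k 0 != 0.
  apply: contrapT => /forallNP H; move/eqP: w0; apply; apply/colP => k.
  by rewrite mxE; apply/eqP; apply: contrapT => /negP /H.
move: k wk; elim/forall_ord3 => wk.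
- exists (mx3 [:: [:: 0; 0; w i0 0]; [:: 1; 0; w i1 0]; [:: 0; (w i0 0)^-1; w i2 0]]).
    apply: unitmx_ker => u /colP E.
    have := (E i0, E i1, E i2); rewrite !mxE !sum3E !mxE /= => -[[e0 e1] e2].
    have u2 : u i2 0 = 0 by apply: (lincomb e0 (c := (w i0 0)^-1)); field.
    rewrite u2 in e1 e2.
    apply/colP; elim/forall_ord3; rewrite mxE //.
      by apply: (lincomb e1 (c := 1)); ring.
    by apply: (lincomb e2 (c := w i0 0)); field.
  by apply/matrixP; do 2 elim/forall_ord3; rewrite !mxE !sum3E !mxE !sum3E !mxE /=; field.
- exists (mx3 [:: [:: 0; (w i1 0)^-1; w i0 0]; [:: 0; 0; w i1 0]; [:: 1; 0; w i2 0]]).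
    apply: unitmx_ker => u /colP E.
    have := (E i0, E i1, E i2); rewrite !mxE !sum3E !mxE /= => -[[e0 e1] e2].
    have u2 : u i2 0 = 0 by apply: (lincomb e1 (c := (w i1 0)^-1)); field.
    rewrite u2 in e0 e2.
    apply/colP; elim/forall_ord3; rewrite mxE //.
      by apply: (lincomb e2 (c := 1)); ring.
    by apply: (lincomb e0 (c := w i1 0)); field.
  by apply/matrixP; do 2 elim/forall_ord3; rewrite !mxE !sum3E !mxE !sum3E !mxE /=; field.
- exists (mx3 [:: [:: 1; 0; w i0 0]; [:: 0; (w i2 0)^-1; w i1 0]; [:: 0; 0; w i2 0]]).
    apply: unitmx_ker => u /colP E.
    have := (E i0, E i1, E i2); rewrite !mxE !sum3E !mxE /= => -[[e0 e1] e2].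
    have u2 : u i2 0 = 0 by apply: (lincomb e2 (c := (w i2 0)^-1)); field.
    rewrite u2 in e0 e1.
    apply/colP; elim/forall_ord3; rewrite mxE //.
      by apply: (lincomb e0 (c := 1)); ring.
    by apply: (lincomb e1 (c := w i2 0)); field.
  by apply/matrixP; do 2 elim/forall_ord3; rewrite !mxE !sum3E !mxE !sum3E !mxE /=; field.
Qed.

(* [jd_form_square], [jd_form_eval], [jd_cyclic] and [jd_exchange], in this order,
   evaluated on the eigenvectors of [diag3 a b c]. *)
Lemma idempotent_mult_skew_constraints a b c w :
  jordan_superalgebras K 1 3 (idempotent_mult a b c w) ->
  [/\ (b - c) ^+ 2 * w i0 0 = 0, (a - c) ^+ 2 * w i1 0 = 0 & (a - b) ^+ 2 * w i2 0 = 0] /\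
  [/\ (b + 2 * c - 1 - 2 * b * c) * w i0 0 = 0,
      (c + 2 * a - 1 - 2 * c * a) * w i1 0 = 0 &
      (a + 2 * b - 1 - 2 * a * b) * w i2 0 = 0] /\
  [/\ (a ^+ 2 - a) * w i0 0 = 0, (b ^+ 2 - b) * w i1 0 = 0 & (c ^+ 2 - c) * w i2 0 = 0] /\
  [/\ a * (b - a) * w i0 0 = 0, b * (c - b) * w i1 0 = 0 & c * (a - c) * w i2 0 = 0].
Proof.
move=> /jordan_mult1_datum jd.
pose e0 := col3 1 0 0 : 'cV[K]_3; pose e1 := col3 0 1 0 : 'cV[K]_3; pose e2 := col3 0 0 1 : 'cV[K]_3.
split; [|split; [|split]]; split.
- by have := jd_form_square jd e1 e2; rewrite !diag3_mulE !oddform_skew3 !col3E => H;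
    apply: (lincomb H (c := 1)); ring.
- by have := jd_form_square jd e2 e0; rewrite !diag3_mulE !oddform_skew3 !col3E => H;
    apply: (lincomb H (c := 1)); ring.
- by have := jd_form_square jd e0 e1; rewrite !diag3_mulE !oddform_skew3 !col3E => H;
    apply: (lincomb H (c := 1)); ring.
- by have := jd_form_eval jd e1 e2; rewrite !diag3_mulE !oddform_skew3 !col3E => H;
    apply: (lincomb H (c := 1)); ring.
- by have := jd_form_eval jd e2 e0; rewrite !diag3_mulE !oddform_skew3 !col3E => H;
    apply: (lincomb H (c := 1)); ring.
- by have := jd_form_eval jd e0 e1; rewrite !diag3_mulE !oddform_skew3 !col3E => H;
    apply: (lincomb H (c := 1)); ring.
- have /colP/(_ i0) := jd_cyclic jd e1 e2 e0.
  rewrite !diag3_mulE !(colDE, colNE, colZE) !oddform_skew3 !col3E => H.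
  by apply: (lincomb H (c := 1)); ring.
- have /colP/(_ i1) := jd_cyclic jd e2 e0 e1.
  rewrite !diag3_mulE !(colDE, colNE, colZE) !oddform_skew3 !col3E => H.
  by apply: (lincomb H (c := 1)); ring.
- have /colP/(_ i2) := jd_cyclic jd e0 e1 e2.
  rewrite !diag3_mulE !(colDE, colNE, colZE) !oddform_skew3 !col3E => H.
  by apply: (lincomb H (c := 1)); ring.
- have /colP/(_ i0) := jd_exchange jd e0 e1 e2.
  rewrite !diag3_mulE !(colDE, colNE, colZE) !oddform_skew3 !col3E => H.
  by apply: (lincomb H (c := 1)); ring.
- have /colP/(_ i1) := jd_exchange jd e1 e2 e0.
  rewrite !diag3_mulE !(colDE, colNE, colZE) !oddform_skew3 !col3E => H.
  by apply: (lincomb H (c := 1)); ring.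
- have /colP/(_ i2) := jd_exchange jd e2 e0 e1.
  rewrite !diag3_mulE !(colDE, colNE, colZE) !oddform_skew3 !col3E => H.
  by apply: (lincomb H (c := 1)); ring.
Qed.

End IdempotentClassification.

Section IdempotentNormalForms.
Context (K : numFieldType).
Implicit Types (al a b c p : K) (A B P : 'M[K]_3) (u v w x y z : 'cV[K]_3).

Lemma has_normal_form_self N a b c w w' :
  normal_form N a b c w -> w' = w -> has_normal_form (idempotent_mult a b c w').
Proof. by move=> nf ->; exists N, a, b, c, w; split=> //; exact: GL_orbit_refl. Qed.

(** A coordinate of [w] dies as soon as one constraint has a nonzero coefficient there. The
    multipliers are inverses of these coefficients: 1/4 or 1 for a squared difference, then -1, -1/4
    and -1/2. The last alternative serves a coordinate that stays free. *)
Local Ltac skew_vanishes constraints :=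
  let f0 := fresh in let f1 := fresh in let f2 := fresh in
  let g0 := fresh in let g1 := fresh in let g2 := fresh in
  let h0 := fresh in let h1 := fresh in let h2 := fresh in
  let k0 := fresh in let k1 := fresh in let k2 := fresh in
  have [[f0 f1 f2] [[g0 g1 g2] [[h0 h1 h2] [k0 k1 k2]]]] := constraints;
  let t f g h k := rewrite mxE /=; first
    [ by apply: (lincomb f (c := 4)); field
    | by apply: (lincomb f (c := 1)); field
    | by apply: (lincomb g (c := -1)); field
    | by apply: (lincomb h (c := -4)); field
    | by apply: (lincomb k (c := -2)); field
    | by [] ] in
  apply/colP; elim/forall_ord3; [t f0 g0 h0 k0 | t f1 g1 h1 k1 | t f2 g2 h2 k2].

(** Rescaling one basis vector outside the radical rescales the form and commutes with the diagonal
    [A]. *)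
Lemma GL_orbit_skew_scale a b p :
  p != 0 -> GL_orbit (idempotent_mult a b b (col3 1 0 0)) (idempotent_mult a b b (col3 p 0 0)).
Proof.
move=> p0; apply/GL_orbit_mult1; exists 1; exists (diag3 1 1 p^-1).
split; rewrite ?oner_eq0 ?mulr1 ?scale1r//.
- apply: (@mulmx1_unitl _ _ (diag3 1 1 p)).
  by apply/matrixP; do 2 elim/forall_ord3; rewrite !mxE !sum3E !mxE /=; field.
- by apply/matrixP; do 2 elim/forall_ord3; rewrite !mxE !sum3E !mxE /=; field.
- by apply/matrixP; do 2 elim/forall_ord3; rewrite !mxE !sum3E !mxE !sum3E !mxE /=; field.
Qed.

Lemma diag_classified_0hh : diag_classified (0 : K) 2^-1 2^-1.
Proof.
move=> w jw; have wE : w = col3 (w i0 0) 0 0 by skew_vanishes (idempotent_mult_skew_constraints jw).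
have [w0|w0] := eqVneq (w i0 0) 0.
  apply: (has_normal_form_self (NF10 K)); rewrite wE w0.
  by apply/colP; elim/forall_ord3; rewrite !mxE.
by exists 2, 0, 2^-1, 2^-1, (col3 1 0 0); split; [exact: NF11 | rewrite wE; exact: GL_orbit_skew_scale].
Qed.

Lemma diag_classified_011 : diag_classified (0 : K) 1 1.
Proof.
move=> w jw; have wE : w = col3 (w i0 0) 0 0 by skew_vanishes (idempotent_mult_skew_constraints jw).
have [w0|w0] := eqVneq (w i0 0) 0.
  apply: (has_normal_form_self (NF13 K)); rewrite wE w0.
  by apply/colP; elim/forall_ord3; rewrite !mxE.
by exists 8, 0, 1, 1, (col3 1 0 0); split; [exact: NF14 | rewrite wE; exact: GL_orbit_skew_scale].
Qed.

Lemma diag3_1 : diag3 1 1 1 = 1%:M :> 'M[K]_3.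
Proof. by apply/matrixP; do 2 elim/forall_ord3; rewrite !mxE. Qed.

(** Here [A] is the identity, so every change of odd basis is allowed and it only matters whether
    the form vanishes. *)
Lemma diag_classified_111 : diag_classified (1 : K) 1 1.
Proof.
move=> w jw; have [->|w0] := eqVneq w 0.
  exact: (has_normal_form_self (NF18 K)).
exists 12, 1, 1, 1, (col3 0 0 1); split; first exact: NF19.
have [P uP PE] := skew_radical_normal w0.
apply/GL_orbit_mult1; exists 1; exists P.
by rewrite oner_eq0 mulr1 !scale1r diag3_1 mulmx1 mul1mx.
Qed.

Lemma diag_classifiedP a b c : a \in [:: 0; 2^-1; 1] -> b \in [:: 0; 2^-1; 1] ->
  c \in [:: 0; 2^-1; 1] -> diag_classified a b c.
Proof.
have c000 : diag_classified (0 : K) 0 0.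
  by move=> w jw; apply: (has_normal_form_self (NF7 K)); skew_vanishes (idempotent_mult_skew_constraints jw).
have c00h : diag_classified (0 : K) 0 2^-1.
  by move=> w jw; apply: (has_normal_form_self (NF8 K)); skew_vanishes (idempotent_mult_skew_constraints jw).
have c001 : diag_classified (0 : K) 0 1.
  by move=> w jw; apply: (has_normal_form_self (NF9 K)); skew_vanishes (idempotent_mult_skew_constraints jw).
have c0h1 : diag_classified (0 : K) 2^-1 1.
  by move=> w jw; apply: (has_normal_form_self (NF12 K)); skew_vanishes (idempotent_mult_skew_constraints jw).
have chhh : diag_classified (2^-1 : K) 2^-1 2^-1.
  by move=> w jw; apply: (has_normal_form_self (NF15 K)); skew_vanishes (idempotent_mult_skew_constraints jw).
have chh1 : diag_classified (2^-1 : K) 2^-1 1.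
  by move=> w jw; apply: (has_normal_form_self (NF16 K)); skew_vanishes (idempotent_mult_skew_constraints jw).
have ch11 : diag_classified (2^-1 : K) 1 1.
  by move=> w jw; apply: (has_normal_form_self (NF17 K)); skew_vanishes (idempotent_mult_skew_constraints jw).
have c0hh := diag_classified_0hh; have c011 := diag_classified_011.
have c111 := diag_classified_111.
have s01 a1 a2 a3 := @diag_classified_swap01 K a1 a2 a3.
have s12 a1 a2 a3 := @diag_classified_swap12 K a1 a2 a3.
(* The two transpositions sort the twenty-seven triples into the ten nondecreasing ones. *)
rewrite !inE => /or3P[] /eqP -> /or3P[] /eqP -> /or3P[] /eqP ->.
- exact: c000.
- exact: c00h.
- exact: c001.
- exact: (s12 _ _ _ c00h).
- exact: c0hh.
- exact: c0h1.
- exact: (s12 _ _ _ c001).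
- exact: (s12 _ _ _ c0h1).
- exact: c011.
- exact: (s01 _ _ _ (s12 _ _ _ c00h)).
- exact: (s01 _ _ _ c0hh).
- exact: (s01 _ _ _ c0h1).
- exact: (s12 _ _ _ (s01 _ _ _ c0hh)).
- exact: chhh.
- exact: chh1.
- exact: (s12 _ _ _ (s01 _ _ _ c0h1)).
- exact: (s12 _ _ _ chh1).
- exact: ch11.
- exact: (s01 _ _ _ (s12 _ _ _ c001)).
- exact: (s01 _ _ _ (s12 _ _ _ c0h1)).
- exact: (s01 _ _ _ c011).
- exact: (s01 _ _ _ (s12 _ _ _ (s01 _ _ _ c0h1))).
- exact: (s01 _ _ _ (s12 _ _ _ chh1)).
- exact: (s01 _ _ _ ch11).
- exact: (s12 _ _ _ (s01 _ _ _ c011)).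
- exact: (s12 _ _ _ (s01 _ _ _ ch11)).
- exact: c111.
Qed.

Lemma idempotent_has_normal_form al A B : al != 0 ->
  jordan_superalgebras K 1 3 (mult1 al A B) -> has_normal_form (mult1 al A B).
Proof.
move=> al0 jm; have [a [b [c [w [ha hb hc orb]]]]] := jordan_diagonalize al0 jm.
have jw := jordan_GL_orbit (GL_orbit_sym orb) jm.
have [N [a' [b' [c' [w' [nf H]]]]]] := diag_classifiedP ha hb hc jw.
by exists N, a', b', c', w'; split=> //; exact: GL_orbit_trans orb.
Qed.

End IdempotentNormalForms.

(** * Rigidity of the algebras with an idempotent *)

Section IdempotentRigid.
Context (K : numFieldType).
Implicit Types (al a b c p : K) (A B P : 'M[K]_3) (u v w x y z : 'cV[K]_3).
Implicit Types (mu : smult K 1 3) (N : nat).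

Definition even_square mu := structure_const mu (lshift 3 ord0) (lshift 3 ord0) (lshift 3 ord0).

Definition trace_square mu := \sum_(j : 'I_3) \sum_(k : 'I_3)
  structure_const mu (lshift 3 ord0) (rshift 1 j) (rshift 1 k)
  * structure_const mu (lshift 3 ord0) (rshift 1 k) (rshift 1 j).

Definition odd_product mu (i j : 'I_3) :=
  structure_const mu (rshift 1 i) (rshift 1 j) (lshift 3 ord0).

Lemma even_square_mult1 al A B : even_square (mult1 al A B) = al.
Proof. by rewrite /even_square structure_const_mult1 /mult1_const !split_lshift. Qed.

Lemma trace_square_mult1 al A B : trace_square (mult1 al A B) = \tr (A *m A).
Proof.
rewrite /mxtrace; apply: eq_bigr => j _; rewrite mxE; apply: eq_bigr => k _.
by rewrite !structure_const_mult1 /mult1_const !split_lshift !split_rshift mulrC.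
Qed.

Lemma odd_product_mult1 al A B i j : odd_product (mult1 al A B) i j = B i j.
Proof. by rewrite /odd_product structure_const_mult1 /mult1_const split_lshift !split_rshift. Qed.

Lemma polyfun_even_square : polyfun (even_square : affine K _ -> K).
Proof. exact: polyfun_structure_const. Qed.

Lemma polyfun_trace_square : polyfun (trace_square : affine K _ -> K).
Proof.
apply: polyfun_sum => j; apply: polyfun_sum => k.
by apply: polyfunM; exact: polyfun_structure_const.
Qed.

(** The equation [4 tr A^2 / al^2 = N] with the denominator cleared, hence polynomial on all
    multiplications. *)
Definition weight_gap N mu := 4 * trace_square mu - N%:R * even_square mu ^+ 2.

Lemma normal_form_weight N a b c w : normal_form N a b c w ->
  4 * (a ^+ 2 + b ^+ 2 + c ^+ 2) = N%:R.
Proof. by case=> {N a b c w}; field. Qed.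

(** The bound lets a finite product of gaps exclude all competing weights. *)
Lemma normal_form_lt13 N a b c w : normal_form N a b c w -> (N < 13)%N.
Proof. by case. Qed.

Lemma normal_form_orbit_invariants N a b c w mu : normal_form N a b c w ->
  GL_orbit (idempotent_mult a b c w) mu -> even_square mu != 0 /\ weight_gap N mu = 0.
Proof.
move=> nf orb.
have [sc _] := jordan_GL_orbit orb (normal_form_jordan nf).
have [al [A [B [_ muE]]]] := supercommutative_mult1 sc.
move: orb; rewrite muE => /GL_orbit_mult1[s [P [s0 uP als sAP _]]].
rewrite /weight_gap even_square_mult1 trace_square_mult1.
have al0 : al != 0 by apply: contra_eq_neq als => ->; rewrite mul0r eq_sym oner_eq0.
split=> //.
have AE : A = al *: (P *m diag3 a b c *m invmx P).
  by rewrite -sAP -scalemxAl mulmxK// scalerA als scale1r.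
have -> : \tr (A *m A) = al ^+ 2 * (a ^+ 2 + b ^+ 2 + c ^+ 2).
  rewrite {1}AE -scalemxAl AE -scalemxAr !mulmxA mulmxKV// -mulmxA.
  rewrite !mxtraceZ mulmxA mxtrace_mulC !mulmxA mulVmx// mul1mx mulrA; congr (_ * _).
  by rewrite /diag3 mulmx_diag /mxtrace sum3E !mxE /=; ring.
by rewrite -(normal_form_weight nf); ring.
Qed.

Lemma weight_gap_inj N M mu : even_square mu != 0 ->
  weight_gap N mu = 0 -> weight_gap M mu = 0 -> N = M.
Proof.
rewrite /weight_gap => e0 /eqP; rewrite subr_eq0 => /eqP -> /eqP.
by rewrite subr_eq0 => /eqP/(mulIf (expf_neq0 2 e0))/eqP; rewrite eqr_nat => /eqP.
Qed.

Lemma odd_product_orbit0 a b c al A B :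
  GL_orbit (idempotent_mult a b c 0) (mult1 al A B) -> B = 0.
Proof.
move=> /GL_orbit_mult1[s [P [_ uP _ _]]].
rewrite skew3_0 scaler0 => PBP.
have uPt : P^T \in unitmx by rewrite unitmx_tr.
by rewrite -[B](mulKmx uPt) -[P^T *m B](mulmxK uP) PBP mul0mx mulmx0.
Qed.

Lemma odd_product_orbit_neq0 a b c w al A B : w != 0 ->
  GL_orbit (idempotent_mult a b c w) (mult1 al A B) -> B <> 0.
Proof.
move=> w0 /GL_orbit_mult1[s [P [s0 uP _ _ PBP]]] B0; move: PBP.
rewrite B0 mulmx0 mul0mx => /esym/eqP; rewrite scaler_eq0 (negPf s0) /= => /eqP.
move=> /matrixP E; move/eqP: w0; apply; apply/colP; elim/forall_ord3; rewrite [RHS]mxE.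
- by have := E i1 i2; rewrite !mxE.
- by have := E i2 i0; rewrite !mxE.
- by have := E i0 i1; rewrite !mxE.
Qed.

(** The second hypothesis says that [w] is generic for its spectrum: any other normal form of weight
    [N] has zero form. So [U1] asks for [al != 0] and excludes every weight but [N], and [U2] asks
    for a nonzero form when [w] is nonzero; both are open. *)
Lemma normal_form_rigid N a b c w : normal_form N a b c w ->
  (forall a' b' c' w', normal_form N a' b' c' w' ->
    [/\ a' = a, b' = b, c' = c & w' = w \/ w' = 0 /\ w != 0]) ->
  rigid (idempotent_mult a b c w).
Proof.
move=> nf uniq_nf.
pose U1 := [set mu | even_square mu * \prod_(v < 13 | v != N :> nat) weight_gap v mu != 0].
pose U2 := [set mu | w != 0 -> ~ forall i, forall j, odd_product mu i j = 0].
exists (U1 `&` U2).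
  apply: openI.
    apply: open_neq0; apply: polyfunM; first exact: polyfun_even_square.
    apply: polyfun_prod => v; apply: polyfunB.
      by apply: polyfunM; [exact: polyfunC | exact: polyfun_trace_square].
    apply: polyfunM; first exact: polyfunC.
    by apply: polyfunM; exact: polyfun_even_square.
  rewrite /U2; case: (w != 0).
    rewrite (_ : [set _ | _] = ~` [set mu | forall i, forall j, odd_product mu i j = 0]).
      rewrite openC; do 2 apply: closed_forall => ?.
      by apply: closed_eq0; exact: polyfun_structure_const.
    by apply/seteqP; split=> mu /= H; [exact: H | move=> _].
  rewrite (_ : [set _ | _] = setT); first exact: openT.
  by apply/seteqP; split=> mu.
apply/seteqP; split=> mu.
- move=> orb; have js := jordan_GL_orbit orb (normal_form_jordan nf).
  have [e0 gap0] := normal_form_orbit_invariants nf orb.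
  split=> //; split=> /=.
    apply: mulf_neq0 => //; apply/prodf_neq0 => v vN.
    by apply: contra_neq vN => /weight_gap_inj; apply.
  have [al [A [B [_ muE]]]] := supercommutative_mult1 js.1.
  rewrite muE in orb *; move=> w0 odd0; apply: (odd_product_orbit_neq0 w0 orb).
  by apply/matrixP => i j; rewrite mxE -(odd0 i j) odd_product_mult1.
- move=> [js [/= U1mu U2mu]].
  have [al [A [B [_ muE]]]] := supercommutative_mult1 js.1.
  move: U1mu; rewrite /U1 /= mulf_eq0 negb_or => /andP[e0 /prodf_neq0 gaps].
  have al0 : al != 0 by move: e0; rewrite muE even_square_mult1.
  have [M [a' [b' [c' [w' [nf' orb]]]]]] : has_normal_form mu.
    by rewrite muE; apply: idempotent_has_normal_form => //; rewrite -muE.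
  have [_ gap0] := normal_form_orbit_invariants nf' orb.
  (* Otherwise the gap of [M] would be a vanishing factor of the product in [U1]. *)
  have MN : M = N.
    apply/eqP; apply: contrapT => /negP MN.
    by have := gaps (Ordinal (normal_form_lt13 nf')) MN; rewrite gap0 eqxx.
  rewrite MN in nf'; have [Ea Eb Ec] := uniq_nf _ _ _ _ nf'.
  rewrite Ea Eb Ec in orb; case=> [Ew|[w'0 w0]]; first by rewrite Ew in orb.
  exfalso; apply: (U2mu w0) => i j; rewrite muE w'0 in orb *.
  by rewrite odd_product_mult1 (odd_product_orbit0 orb) mxE.
Qed.

End IdempotentRigid.

(** * Degenerations and rigidity *)

Section Degenerations.
Context (K : numFieldType).
Implicit Types (al a b c p : K) (A B P : 'M[K]_3) (u v w x y z t : 'cV[K]_3).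
Implicit Types (phi : 'rV[K]_3) (mu : smult K 1 3).

Lemma lincomb3 (c1 c2 c3 a1 a2 a3 x : K) : a1 = 0 -> a2 = 0 -> a3 = 0 ->
  x = c1 * a1 + c2 * a2 + c3 * a3 -> x = 0.
Proof. by move=> -> -> -> ->; rewrite !mulr0 !addr0. Qed.

Definition cols3 x y z : 'M[K]_3 := \matrix_(i, j) nth 0 [:: x i 0; y i 0; z i 0] j.

Lemma cols3_mul x y z u : cols3 x y z *m u = u i0 0 *: x + u i1 0 *: y + u i2 0 *: z.
Proof. by apply/colP => k; rewrite mxE sum3E !mxE /=; ring. Qed.

(** All degenerations below are of this shape: the point [s = 0] of an affine line in the triple, a
    curve with denominator 1, where [c] collects the exceptional parameters. *)
Lemma mult1_line_in_closed (C : set (smult K 1 3)) (c : {poly K}) al0 al1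
    (A0 A1 B0 B1 : 'M[K]_3) : closed C -> c != 0 ->
  (forall s, c.[s] != 0 -> C (mult1 (al0 + s * al1) (A0 + s *: A1) (B0 + s *: B1))) ->
  C (mult1 al0 A0 B0).
Proof.
move=> Ccl c0 CC.
pose gam s : smult K 1 3 := mult1 (al0 + s * al1) (A0 + s *: A1) (B0 + s *: B1).
have -> : mult1 al0 A0 B0 = gam 0 by rewrite /gam mul0r !scale0r !addr0.
pose n (i : graded_triple 1 3) : {poly K} :=
  (affine_fun (mult1 al0 A0 B0) i)%:P + 'X * (affine_fun (mult1 al1 A1 B1) i)%:P.
apply: (@rational_curve_in_closed K _ C gam n 1 c Ccl _ c0); last by rewrite hornerC oner_eq0.
- move=> s _ i; rewrite /n !hornerE /gam /affine_fun !ffunE /mult1_const.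
  by do 3 case: fintype.split => ?; rewrite ?mxE ?mulr0 ?addr0.
- by move=> s cs _; exact: CC.
Qed.

Definition dot phi u := (phi *m u) 0 0.

Lemma dotE phi u : dot phi u = phi 0 i0 * u i0 0 + phi 0 i1 * u i1 0 + phi 0 i2 * u i2 0.
Proof. by rewrite /dot mxE sum3E. Qed.

Lemma dotD phi u v : dot phi (u + v) = dot phi u + dot phi v.
Proof. by rewrite !dotE !colDE; ring. Qed.

Lemma dotZ phi a u : dot phi (a *: u) = a * dot phi u.
Proof. by rewrite !dotE !colZE; ring. Qed.

Lemma rank1_mul v phi u : v *m phi *m u = dot phi u *: v.
Proof. by rewrite -mulmxA {1}[phi *m u]mx11_scalar mul_mx_scalar. Qed.

Lemma skew3_radical w u : oddform (skew3 w) w u = 0.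
Proof. by rewrite oddform_skew3; ring. Qed.

Lemma skew3_radicalr w u : oddform (skew3 w) u w = 0.
Proof. by rewrite oddform_skew3; ring. Qed.

Lemma skew3_alternating w u : oddform (skew3 w) u u = 0.
Proof. by rewrite oddform_skew3; ring. Qed.

Lemma J5_mulE u : (delta_mx i1 i0 : 'M[K]_3) *m u = col3 0 (u i0 0) 0.
Proof. by apply/colP; elim/forall_ord3; rewrite !mxE sum3E !mxE /=; ring. Qed.

(** Here [A = v phi]. The first hypothesis is [A^2 = 0]; the second says that [e] does not kill the
    radical vector [w]. Then [v] is not proportional to [w], and a basis with the products of [J5]
    can be written down. *)
Lemma rank1_orbit_J5 v phi w : dot phi v = 0 -> dot phi w != 0 -> v != 0 ->
  GL_orbit (J5 K) (mult1 0 (v *m phi) (skew3 w)).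
Proof.
move=> phiv phiw v0.
have [h hE] : exists h, oddform (skew3 w) v h = 1.
  suff [h h0] : exists h, oddform (skew3 w) v h != 0.
    exists ((oddform (skew3 w) v h)^-1 *: h); by rewrite oddformZr mulVf.
  apply: contrapT => /forallNP H; move/eqP: v0; apply.
  have {}H h : oddform (skew3 w) v h = 0 by apply/eqP; apply: contrapT => /negP /H.
  have := (H (col3 1 0 0), H (col3 0 1 0), H (col3 0 0 1)).
  rewrite !oddform_skew3 !col3E => -[[H0 H1] H2].
  move: phiv phiw; rewrite !dotE => phiv phiw.
  (* The triple product identity phi x (w x v) = (phi . v) w - (phi . w) v: if w x v and phi . v
     vanish, so does (phi . w) v. *)
  apply/colP; elim/forall_ord3; rewrite [RHS]mxE; apply: (mulfI phiw); rewrite mulr0.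
  - by apply: (lincomb3 phiv H1 H2 (c1 := w i0 0) (c2 := phi 0 i2) (c3 := - phi 0 i1)); ring.
  - by apply: (lincomb3 phiv H2 H0 (c1 := w i1 0) (c2 := phi 0 i0) (c3 := - phi 0 i2)); ring.
  - by apply: (lincomb3 phiv H0 H1 (c1 := w i2 0) (c2 := phi 0 i1) (c3 := - phi 0 i0)); ring.
(* [f1] is the radical vector normalised by [phi]. Subtracting a multiple of it from [h] puts [f3]
   into the kernel of [phi] without changing its values under the form. *)
pose f1 := (dot phi w)^-1 *: w.
pose f3 := h - dot phi h *: f1.
have phif1 : dot phi f1 = 1 by rewrite /f1 dotZ mulVf.
have phif3 : dot phi f3 = 0 by rewrite /f3 -scaleNr dotD dotZ phif1; ring.
have f1l u : oddform (skew3 w) f1 u = 0 by rewrite oddformZl skew3_radical mulr0.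
have f1r u : oddform (skew3 w) u f1 = 0 by rewrite oddformZr skew3_radicalr mulr0.
have vf3 : oddform (skew3 w) v f3 = 1.
  by rewrite /f3 oddformDr -scaleNr oddformZr f1r mulr0 addr0.
have f3v : oddform (skew3 w) f3 v = -1.
  by rewrite (oddform_skew _ _ (skew3_tr w)) vf3.
clearbody f3 f1.
rewrite J5E; apply/GL_orbit_mult1; exists 1; exists (cols3 f1 v f3).
split; rewrite ?oner_eq0 ?mul0r ?scale1r//.
- apply: unitmx_ker => u; rewrite cols3_mul => Pu.
  have u0 : u i0 0 = 0.
    have := congr1 (dot phi) Pu; rewrite !(dotD, dotZ) phif1 phiv phif3 dotE !mxE.
    by rewrite !mulr0 !addr0 mulr1.
  have u2 : u i2 0 = 0.
    have := congr1 (oddform (skew3 w) v) Pu; rewrite !(oddformDr, oddformZr) f1r vf3 skew3_alternating oddform0r.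
    by rewrite !mulr0 !add0r mulr1.
  move: Pu; rewrite u0 u2 !scale0r add0r addr0 => /eqP.
  rewrite scaler_eq0 (negPf v0) orbF => /eqP u1.
  by apply/colP; elim/forall_ord3; rewrite [RHS]mxE.
- apply: eq_mulmx_col => u; rewrite -!mulmxA J5_mulE !cols3_mul !col3E !scale0r add0r addr0.
  rewrite !mulmxA rank1_mul !(dotD, dotZ) phif1 phiv phif3.
  by rewrite !mulr0 !addr0 mulr1.
- apply: oddform_ext => u u'; rewrite oddform_congr !cols3_mul.
  rewrite !(oddformDl, oddformDr, oddformZl, oddformZr) !f1l !f1r !skew3_alternating vf3 f3v.
  by rewrite oddform_skew3 !col3E; ring.
Qed.

End Degenerations.

Section Closures.
Context (K : numFieldType).
Implicit Types (al a b c p : K) (A B P : 'M[K]_3) (u v w x y z t : 'cV[K]_3).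
Implicit Types (phi : 'rV[K]_3) (mu : smult K 1 3).

Lemma square0_rank1 A : A *m A = 0 -> A != 0 ->
  exists v phi, [/\ A = v *m phi, v != 0, phi != 0 & dot phi v = 0].
Proof.
move=> AA A0.
have rk : \rank A = 1%N.
  have := mulmx0_rank_max AA; have : (0 < \rank A)%N by rewrite lt0n mxrank_eq0.
  by case: (\rank A) => [|[|r]] // _; rewrite !addSn !addnS.
have := mulmx_base A; move: (col_base A) (row_base A); rewrite rk => v phi vphi.
have v0 : v != 0 by apply: contra_neq A0 => v0; rewrite -vphi v0 mul0mx.
have phi0 : phi != 0 by apply: contra_neq A0 => phi0; rewrite -vphi phi0 mulmx0.
exists v, phi; split=> //; move/eqP: AA; rewrite -vphi mulmxA rank1_mul -scalemxAl.
by rewrite scaler_eq0 vphi (negPf A0) orbF => /eqP.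
Qed.

(** For [A != 0] only [dot phi w != 0] can fail, and this holds after a generic shift of [w]. The
    case [A = 0] is then a second limit. *)
Lemma square0_closure_J5 A w : A *m A = 0 ->
  closure (GL_orbit (J5 K)) (mult1 0 A (skew3 w)).
Proof.
have cl := @closed_closure _ (GL_orbit (J5 K)).
have nz A' : A' *m A' = 0 -> A' != 0 -> closure (GL_orbit (J5 K)) (mult1 0 A' (skew3 w)).
  move=> AA A0; have [v [phi [AE v0 phi0 phiv]]] := square0_rank1 AA A0.
  have [k phik] : exists k, phi 0 k != 0.
    apply: contrapT => /forallNP H; move/eqP: phi0; apply; apply/rowP => k.
    by rewrite mxE; apply/eqP; apply: contrapT => /negP /H.
  have dk : dot phi (delta_mx k 0) = phi 0 k by rewrite /dot -colE mxE.
  (* The value of [phi] on the shifted [w]; its linear coefficient is nonzero by the choice of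
     [k]. *)
  pose c : {poly K} := (dot phi w)%:P + 'X * (phi 0 k)%:P.
  have c0 : c != 0.
    apply: contra_neq phik => /(congr1 (fun q : {poly K} => q`_1)).
    by rewrite coefD coefC coefXM coefC coef0 add0r.
  apply: (mult1_line_in_closed (al1 := 0) (A1 := 0) (B1 := skew3 (delta_mx k 0)) cl c0).
  move=> s cs; rewrite mulr0 addr0 scaler0 addr0 -skew3Z.
  have -> : skew3 w + skew3 (s *: delta_mx k 0) = skew3 (w + s *: delta_mx k 0).
    by apply/matrixP; do 2 elim/forall_ord3; rewrite !mxE /=; ring.
  apply: subset_closure; rewrite AE; apply: rank1_orbit_J5 => //.
  by rewrite dotD dotZ dk; move: cs; rewrite /c !hornerE.
move=> AA; have [->|A0] := eqVneq A 0; last exact: nz.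
apply: (mult1_line_in_closed (al1 := 0) (A1 := delta_mx i1 i0) (B1 := 0) cl (negbT (polyX_eq0 _))).
move=> s; rewrite hornerX => s0; rewrite mulr0 addr0 add0r scaler0 addr0.
have dd : delta_mx i1 i0 *m delta_mx i1 i0 = 0 :> 'M[K]_3 by rewrite mul_delta_mx_0.
apply: nz; first by rewrite -scalemxAl -scalemxAr dd !scaler0.
rewrite scaler_eq0 (negPf s0) /=; apply/eqP => /matrixP/(_ i1 i0).
by rewrite !mxE !eqxx => /eqP; rewrite oner_eq0.
Qed.

Lemma nilpotent_basis A : (forall u, A *m (A *m (A *m u)) = 0) -> A *m A != 0 ->
  exists v, cols3 v (A *m v) (A *m (A *m v)) \in unitmx /\ A *m (A *m v) != 0.
Proof.
move=> A3 AA0.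
have [v v0] : exists v, A *m (A *m v) != 0.
  apply: contrapT => /forallNP H; move/eqP: AA0; apply; apply: eq_mulmx_col => u.
  by rewrite mul0mx -mulmxA; apply/eqP; apply: contrapT => /negP /H.
exists v; split=> //; apply: unitmx_ker => u; rewrite cols3_mul => Pu.
have u0 : u i0 0 = 0.
  have /eqP := congr1 (fun x => A *m (A *m x)) Pu.
  rewrite !(mulmxDr, mulmx0) -!scalemxAr !A3 !mulmx0 !scaler0 !addr0.
  by rewrite scaler_eq0 (negPf v0) orbF => /eqP.
move: Pu; rewrite u0 scale0r add0r => Pu.
have u1 : u i1 0 = 0.
  have /eqP := congr1 (fun x => A *m x) Pu.
  rewrite !(mulmxDr, mulmx0) -!scalemxAr !A3 !scaler0 !addr0.
  by rewrite scaler_eq0 (negPf v0) orbF => /eqP.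
move: Pu; rewrite u1 scale0r add0r => /eqP.
rewrite scaler_eq0 (negPf v0) orbF => /eqP u2.
by apply/colP; elim/forall_ord3; rewrite [RHS]mxE.
Qed.

Lemma jordan_nilpotent A B : jordan_datum 0 A B -> forall u, A *m (A *m (A *m u)) = 0.
Proof.
move=> jd u; have /eqP := jd_cubic jd u.
rewrite expr0n /= scale0r addr0 mulr0 scale0r scaler_eq0 pnatr_eq0 /=.
by move=> /eqP.
Qed.

(** The exchange equation at [v], [A v], once multiplied by [A], puts [A^2 v] in the radical of [B].
    What is left of it is 2 B(A v, z) A^2 v = 0, so [A v] is in the radical as well, and B(v, v) = 0
    by skew-symmetry. *)
Lemma jordan_nilpotent_form0 A B : jordan_datum 0 A B -> A *m A != 0 -> B = 0.
Proof.
move=> jd AA; have A3 := jordan_nilpotent jd.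
have [v [uP v0]] := nilpotent_basis A3 AA.
set P := cols3 _ _ _ in uP.
have E z := jd_exchange jd v (A *m v) z.
have f2 z : oddform B (A *m (A *m v)) z = 0.
  have /eqP := congr1 (fun x => A *m x) (E z).
  rewrite !mulmxBr -!scalemxAr !A3 !mulmx0 !scaler0 !subr0.
  by rewrite scaler_eq0 (negPf v0) orbF => /eqP.
have f1 z : oddform B (A *m v) z = 0.
  have := E z; rewrite f2 scale0r sub0r A3 scaler0 subr0 => /eqP.
  rewrite eq_sym -addr_eq0 -scalerDl scaler_eq0 (negPf v0) orbF.
  by rewrite -mulr2n -mulr_natl mulf_eq0 pnatr_eq0 => /eqP.
have sk := @oddform_skew _ _ B _ _ (jd_skew jd).
have f0 : oddform B v v = 0.
  have /eqP := sk v v; rewrite -addr_eq0 -mulr2n -mulr_natl mulf_eq0 pnatr_eq0.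
  by move=> /eqP.
have PBP : P^T *m B *m P = 0.
  apply: oddform_ext => x y; rewrite oddform_congr oddform_0 /P !cols3_mul.
  rewrite !(oddformDl, oddformDr, oddformZl, oddformZr) !f1 !f2 !f0.
  by rewrite !(sk v) !f1 !f2; ring.
have uPt : P^T \in unitmx by rewrite unitmx_tr.
by rewrite -[B](mulKmx uPt) -[P^T *m B](mulmxK uP) PBP mul0mx mulmx0.
Qed.

(** Weight 5 belongs to a single normal form, so membership in the orbit is recognised without a
    change of basis. *)
Lemma J12_orbitP mu : jordan_superalgebras K 1 3 mu -> even_square mu != 0 ->
  weight_gap 5 mu = 0 -> GL_orbit (J12 K) mu.
Proof.
move=> js e0 gap; have [al [A [B [_ muE]]]] := supercommutative_mult1 js.1.
have [N [a [b [c [w [nf orb]]]]]] : has_normal_form mu.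
  rewrite muE; apply: idempotent_has_normal_form; last by rewrite -muE.
  by move: e0; rewrite muE even_square_mult1.
have [_ gapN] := normal_form_orbit_invariants nf orb.
rewrite J12E; move: nf orb; rewrite (weight_gap_inj e0 gapN gap) => nf.
by inversion nf.
Qed.

(** In the basis [v], [A v], [A^2 v] the matrix is a nilpotent Jordan block. Adding [s] times
    diag(0, 1/2, 1) and taking [al = s] makes it triangular with eigenvalues 0, s/2, s, which gives
    the cubic equation and weight 5. *)
Lemma nilpotent_closure_J12 A : (forall u, A *m (A *m (A *m u)) = 0) -> A *m A != 0 ->
  closure (GL_orbit (J12 K)) (mult1 0 A 0).
Proof.
move=> A3 AA; have [v [uP v0]] := nilpotent_basis A3 AA.
set P := cols3 _ _ _ in uP.
pose N : 'M[K]_3 := mx3 [:: [:: 0; 0; 0]; [:: 1; 0; 0]; [:: 0; 1; 0]].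
have AP : A = P *m N *m invmx P.
  rewrite -[LHS](mulmxK uP); congr (_ *m _); apply: eq_mulmx_col => u.
  rewrite -!mulmxA /P !cols3_mul !mulmxDr -!scalemxAr A3 scaler0 addr0.
  have -> : N *m u = col3 0 (u i0 0) (u i1 0).
    by apply/colP; elim/forall_ord3; rewrite !mxE sum3E !mxE /=; ring.
  by rewrite !col3E scale0r add0r.
have cl := @closed_closure _ (GL_orbit (J12 K)).
apply: (mult1_line_in_closed (al1 := 1) (A1 := P *m diag3 0 2^-1 1 *m invmx P) (B1 := 0) cl (negbT (polyX_eq0 _))).
move=> s; rewrite hornerX => s0; rewrite mulr1 add0r scaler0 addr0.
apply: subset_closure.
pose M : 'M[K]_3 := N + s *: diag3 0 2^-1 1.
have -> : A + s *: (P *m diag3 0 2^-1 1 *m invmx P) = P *m M *m invmx P.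
  by rewrite [in LHS]AP scalemxAl scalemxAr -mulmxDl -mulmxDr.
have PMu u : P *m M *m invmx P *m (P *m u) = P *m (M *m u).
  by rewrite -[LHS]mulmxA mulKmx// mulmxA.
apply: J12_orbitP.
- apply: jordan_mult1; apply: jordan_datum_form0 => u.
  rewrite -[u](mulKVmx uP); set u' := invmx P *m u; rewrite !PMu.
  rewrite !(scalemxAr _ P) -mulmxDr; congr (_ *m _).
  have ME z : M *m z = col3 0 (z i0 0 + s / 2 * z i1 0) (z i1 0 + s * z i2 0).
    by apply/colP; elim/forall_ord3; rewrite !mxE sum3E !mxE /=; ring.
  by rewrite !ME !col3E; apply/colP; elim/forall_ord3; rewrite !(colDE, colZE) !col3E; field.
- by rewrite even_square_mult1.
- rewrite /weight_gap even_square_mult1 trace_square_mult1.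
  rewrite -!mulmxA (mulKmx uP) mxtrace_mulC -!mulmxA mulVmx// mulmx1.
  by rewrite /mxtrace sum3E !mxE !sum3E !mxE /=; field.
Qed.

Lemma odd_product_scale_orbit a b c w al A B p : p != 0 ->
  GL_orbit (idempotent_mult a b c w) (idempotent_mult a b c (p *: w)) ->
  GL_orbit (idempotent_mult a b c w) (mult1 al A B) ->
  GL_orbit (idempotent_mult a b c w) (mult1 al A (p *: B)).
Proof.
move=> p0 sc /GL_orbit_mult1[s [P [s0 uP als sAP PBP]]].
apply: GL_orbit_trans sc _; apply/GL_orbit_mult1; exists s, P; split=> //.
by rewrite skew3Z -scalemxAr -scalemxAl PBP !scalerA mulrC.
Qed.

(** All nonzero multiples of the form stay in the orbit, so the form can be scaled to zero. *)
Lemma idempotent_mult_skew0_closure a b c w mu :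
  (forall p, p != 0 -> GL_orbit (idempotent_mult a b c w) (idempotent_mult a b c (p *: w))) ->
  jordan_superalgebras K 1 3 mu ->
  GL_orbit (idempotent_mult a b c 0) mu -> closure (GL_orbit (idempotent_mult a b c w)) mu.
Proof.
move=> sc js orb; have [al [A [B [_ muE]]]] := supercommutative_mult1 js.1.
rewrite muE in orb *; rewrite (odd_product_orbit0 orb).
move: orb => /GL_orbit_mult1[s [P [s0 uP als sAP _]]].
have uPt : P^T \in unitmx by rewrite unitmx_tr.
(* The form obtained from [w] by the same [s] and [P] that carry the form-free algebra to [mu]. *)
pose B1 := s *: (invmx P^T *m skew3 w *m invmx P).
have orb1 : GL_orbit (idempotent_mult a b c w) (mult1 al A B1).
  apply/GL_orbit_mult1; exists s, P; split=> //.
  by rewrite /B1 -scalemxAr -scalemxAl -!mulmxA mulVmx// mulmx1 mulKVmx.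
have cl := @closed_closure _ (GL_orbit (idempotent_mult a b c w)).
apply: (mult1_line_in_closed (al1 := 0) (A1 := 0) (B1 := B1) cl (negbT (polyX_eq0 _))).
move=> p; rewrite hornerX => p0; rewrite mulr0 addr0 scaler0 addr0 add0r.
by apply: subset_closure; apply: odd_product_scale_orbit => //; exact: sc.
Qed.

Lemma skew_scale_0bb (b p : K) : p != 0 ->
  GL_orbit (idempotent_mult 0 b b (col3 1 0 0)) (idempotent_mult 0 b b (p *: col3 1 0 0)).
Proof.
move=> p0; have -> : p *: col3 1 0 0 = col3 p 0 0.
  by apply/colP; elim/forall_ord3; rewrite !mxE /= ?mulr1 ?mulr0.
exact: GL_orbit_skew_scale.
Qed.

Lemma skew_scale_111 (p : K) : p != 0 ->
  GL_orbit (idempotent_mult 1 1 1 (col3 0 0 1)) (idempotent_mult 1 1 1 (p *: col3 0 0 1)).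
Proof.
move=> p0; have pw : p *: col3 0 0 1 != 0.
  rewrite scaler_eq0 (negPf p0) /=; apply/eqP => /colP/(_ i2).
  by rewrite !mxE /= => /eqP; rewrite oner_eq0.
have [P uP PE] := skew_radical_normal pw.
apply/GL_orbit_mult1; exists 1; exists P.
by rewrite oner_eq0 mulr1 !scale1r diag3_1 mulmx1 mul1mx.
Qed.

Lemma jordan_covered mu : jordan_superalgebras K 1 3 mu ->
  exists i : 'I_11, closure (GL_orbit (tnth (J_list K) i)) mu.
Proof.
move=> js; have [al [A [B [sB muE]]]] := supercommutative_mult1 js.1.
have jd : jordan_datum al A B by apply: jordan_mult1_datum; rewrite -muE.
have witness (i : 'I_11) nu : tnth (J_list K) i = nu -> closure (GL_orbit nu) mu ->
  exists i : 'I_11, closure (GL_orbit (tnth (J_list K) i)) mu.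
  by move=> <-; exists i.
have [al0|al0] := eqVneq al 0.
  rewrite al0 in muE jd; have [AA|AA] := eqVneq (A *m A) 0.
    have [w wE] := skew3_surj sB.
    apply: (witness (inord 0) (J5 K)); first by rewrite (tnth_nth (J5 K)) inordK.
    by rewrite muE wE; exact: square0_closure_J5.
  apply: (witness (inord 5) (J12 K)); first by rewrite (tnth_nth (J5 K)) inordK.
  rewrite muE (jordan_nilpotent_form0 jd AA).
  by apply: nilpotent_closure_J12 => //; exact: jordan_nilpotent jd.
have [N [a [b [c [w [nf orb]]]]]] : has_normal_form mu.
  by rewrite muE; apply: idempotent_has_normal_form => //; rewrite -muE.
have sub nu : GL_orbit nu mu -> closure (GL_orbit nu) mu by exact: subset_closure.
case: nf orb => orb.
- apply: (witness (inord 1) (J7 K)); [by rewrite (tnth_nth (J5 K)) inordK | by rewrite J7E; exact: sub].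
- apply: (witness (inord 2) (J8 K)); [by rewrite (tnth_nth (J5 K)) inordK | by rewrite J8E; exact: sub].
- apply: (witness (inord 3) (J9 K)); [by rewrite (tnth_nth (J5 K)) inordK | by rewrite J9E; exact: sub].
- apply: (witness (inord 4) (J11 K)); first by rewrite (tnth_nth (J5 K)) inordK.
  by rewrite J11E; apply: idempotent_mult_skew0_closure => // p; exact: skew_scale_0bb.
- apply: (witness (inord 4) (J11 K)); [by rewrite (tnth_nth (J5 K)) inordK | by rewrite J11E; exact: sub].
- apply: (witness (inord 5) (J12 K)); [by rewrite (tnth_nth (J5 K)) inordK | by rewrite J12E; exact: sub].
- apply: (witness (inord 6) (J14 K)); first by rewrite (tnth_nth (J5 K)) inordK.
  by rewrite J14E; apply: idempotent_mult_skew0_closure => // p; exact: skew_scale_0bb.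
- apply: (witness (inord 6) (J14 K)); [by rewrite (tnth_nth (J5 K)) inordK | by rewrite J14E; exact: sub].
- apply: (witness (inord 7) (J15 K)); [by rewrite (tnth_nth (J5 K)) inordK | by rewrite J15E; exact: sub].
- apply: (witness (inord 8) (J16 K)); [by rewrite (tnth_nth (J5 K)) inordK | by rewrite J16E; exact: sub].
- apply: (witness (inord 9) (J17 K)); [by rewrite (tnth_nth (J5 K)) inordK | by rewrite J17E; exact: sub].
- apply: (witness (inord 10) (J19 K)); first by rewrite (tnth_nth (J5 K)) inordK.
  by rewrite J19E; apply: idempotent_mult_skew0_closure => // p; exact: skew_scale_111.
- apply: (witness (inord 10) (J19 K)); [by rewrite (tnth_nth (J5 K)) inordK | by rewrite J19E; exact: sub].
Qed.

End Closures.

(** * Rigidity of [J5] and disjointness of the eleven orbits *)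

Section Rigidity.
Context (K : numFieldType).
Implicit Types (al a b c p : K) (A B P : 'M[K]_3) (u v : 'cV[K]_3).
Implicit Types (phi : 'rV[K]_3) (mu : smult K 1 3).

(* [(xy)t + (tx)y + (yt)x] is [e] times a vector of the radical of the form
   [B], so the product vanishes unless that radical is moved by [e]. *)
Definition radical_product mu (x y t w : 'cV[K]_(1 + 3)) :=
  smul mu (smul mu (smul mu x y) t + smul mu (smul mu t x) y + smul mu (smul mu y t) x) w.

Definition radical_moved mu := exists x y t w,
  [/\ homogeneous true x, homogeneous true y, homogeneous true t & homogeneous true w]
  /\ radical_product mu x y t w <> 0.

(** The complement is an intersection of polynomial equations, one for each quadruple of odd
    vectors. *)
Lemma open_radical_moved : open (radical_moved : set (smult K 1 3)).
Proof.
rewrite (_ : radical_moved = ~` [set mu | forall x y t w,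
  [/\ homogeneous true x, homogeneous true y, homogeneous true t & homogeneous true w]
  -> radical_product mu x y t w = 0]).
  rewrite openC; do 4 apply: closed_forall => ?; apply: closed_imply.
  apply: closed_polyvec_eq; last exact: polyvec_cst.
  by repeat first [exact: polyvec_cst | apply: polyvecD | apply: polyvec_smul].
apply/seteqP; split=> mu /=.
  by move=> [x [y [t [w [h ne]]]]] H; apply: ne; exact: H.
move=> H; apply: contrapT => nm; apply: H => x y t w h.
by apply: contrapT => ne; apply: nm; exists x, y, t, w.
Qed.

Lemma radical_moved_orbit mu nu : GL_orbit mu nu -> radical_moved mu -> radical_moved nu.
Proof.
move=> /GL_orbitP[g gg E] [x [y [t [w [[hx hy ht hw] ne]]]]].
exists (g *m x), (g *m y), (g *m t), (g *m w); split.
  by split; exact: homogeneous_graded_GL.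
rewrite /radical_product !E -!mulmxDr E => gne; apply: ne.
by rewrite -[LHS](mulKmx (graded_GL_unit gg)) gne mulmx0.
Qed.

Lemma radical_product_mult1 al A B x y t w :
  radical_product (mult1 al A B) (vec 0 x) (vec 0 y) (vec 0 t) (vec 0 w) =
  vec (oddform B (A *m (oddform B x y *: t + oddform B t x *: y + oddform B y t *: x)) w) 0.
Proof. by rewrite /radical_product !smul_vecE !vecD !addr0 !scalemxAr -!mulmxDr !smul_vecE. Qed.

(** Cramer's rule: the linear dependence of four vectors in dimension three, with determinants as
    coefficients. *)
Lemma skew3_cramer (w x y t : 'cV[K]_3) :
  oddform (skew3 w) x y *: t + oddform (skew3 w) t x *: y + oddform (skew3 w) y t *: x
  = oddform (skew3 x) y t *: w.
Proof.
by apply/colP; elim/forall_ord3; rewrite !colDE !colZE !oddform_skew3; ring.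
Qed.

Lemma vec0 : vec 0 0 = 0 :> 'cV[K]_(1 + 3).
Proof. by rewrite /vec raddf0 col_mx0. Qed.

Lemma J5_radical_moved : radical_moved (J5 K).
Proof.
exists (vec 0 (col3 1 0 0)), (vec 0 (col3 0 1 0)), (vec 0 (col3 0 0 1)), (vec 0 (col3 0 0 1)).
split; first by split; exact: homogeneous_odd.
rewrite J5E radical_product_mult1 skew3_cramer -scalemxAr oddformZl.
rewrite J5_mulE !oddform_skew3 !col3E -vec0 => /vec_inj[/eqP + _].
rewrite (_ : _ * _ = 1); first by rewrite oner_eq0.
by ring.
Qed.

(** The right side of [jd_form_eval] is alternating, so the sum over (u, v) and (v, u) leaves only
    the difference of the two terms. Hence for [al != 0] the matrix [A] preserves the radical of
    [B]. *)
Lemma jordan_datum_selfadjoint al A B u v : al != 0 -> jordan_datum al A B ->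
  oddform B (A *m u) v = oddform B u (A *m v).
Proof.
move=> al0 jd; have sk := @oddform_skew _ _ B _ _ (jd_skew jd).
apply: (mulfI al0); have H := jd_form_eval jd u v.
have := jd_form_eval jd v u.
rewrite (sk (A *m v) u) (sk v (A *m u)) (sk v u) (sk (A *m v) (A *m u)) => H'.
by apply: (lincomb (congr2 +%R H H') (c := -1)); ring.
Qed.

(** A moved radical excludes [al != 0] by self-adjointness, and [A^2 <> 0] because then [B = 0]. It
    also gives the condition [dot phi b != 0] of [rank1_orbit_J5]. *)
Lemma J5_orbitP mu : jordan_superalgebras K 1 3 mu -> radical_moved mu ->
  GL_orbit (J5 K) mu.
Proof.
move=> js; have [al [A [B [sB muE]]]] := supercommutative_mult1 js.1.
have jd : jordan_datum al A B by apply: jordan_mult1_datum; rewrite -muE.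
have [b bE] := skew3_surj sB.
move=> [x' [y' [t' [w' [[/homogeneous_vecP [x ->] /homogeneous_vecP [y ->]
  /homogeneous_vecP [t ->] /homogeneous_vecP [w ->]]]]]]].
rewrite muE radical_product_mult1 bE skew3_cramer -scalemxAr oddformZl => ne.
have {}ne : oddform (skew3 x) y t * oddform (skew3 b) (A *m b) w <> 0.
  by move=> e0; apply: ne; rewrite e0 vec0.
have Abw : oddform (skew3 b) (A *m b) w <> 0 by move=> e0; apply: ne; rewrite e0 mulr0.
have al0 : al = 0.
  apply/eqP; apply: contrapT => /negP al0; apply: Abw.
  by rewrite -bE (jordan_datum_selfadjoint _ _ al0 jd) bE skew3_radical.
rewrite al0 in muE jd *.
have AA : A *m A = 0.
  apply/eqP; apply: contrapT => /negP AA; apply: Abw.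
  by rewrite -bE (jordan_nilpotent_form0 jd AA) oddform_0.
have A0 : A != 0 by apply/eqP => A0; apply: Abw; rewrite A0 mul0mx oddform0l.
have [v [phi [AE v0 _ phiv]]] := square0_rank1 AA A0.
rewrite AE; apply: rank1_orbit_J5 => //.
by apply/eqP => phib; apply: Abw; rewrite AE rank1_mul phib scale0r oddform0l.
Qed.

Lemma J5_rigid : rigid (J5 K).
Proof.
exists radical_moved; first exact: open_radical_moved.
apply/seteqP; split=> mu; last by move=> [js]; exact: J5_orbitP.
move=> orb; split; first exact: jordan_GL_orbit orb (J5_jordan K).
exact: radical_moved_orbit orb J5_radical_moved.
Qed.

(* 7 is a placeholder for [J5], the only entry with [e^2 = 0]; no other entry has that weight. *)
Definition J_weights := [:: 7; 0; 1; 4; 2; 5; 8; 3; 6; 9; 12]%N.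

Definition has_weight N mu := if N == 7%N then even_square mu = 0
  else even_square mu != 0 /\ weight_gap N mu = 0.

Lemma has_weight_inj N M mu : has_weight N mu -> has_weight M mu -> N = M.
Proof.
rewrite /has_weight; case: (N =P 7) => [->|_]; case: (M =P 7) => [->|_] //.
- by move=> -> []; rewrite eqxx.
- by move=> [e0 _] e1; rewrite e1 eqxx in e0.
- by move=> [e0 NE] [_ ME]; exact: weight_gap_inj NE ME.
Qed.

Lemma J5_weight mu : GL_orbit (J5 K) mu -> has_weight 7 mu.
Proof.
move=> orb; have js := jordan_GL_orbit orb (J5_jordan K).
have [al [A [B [sB muE]]]] := supercommutative_mult1 js.1.
move: orb; rewrite J5E muE => /GL_orbit_mult1[s [P [s0 _ /eqP als _ _]]].
rewrite /has_weight eqxx even_square_mult1.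
by move: als; rewrite mulf_eq0 (negPf s0) orbF => /eqP.
Qed.

Lemma J_listP (i : 'I_11) : let mu := tnth (J_list K) i in
  [/\ jordan_superalgebras K 1 3 mu, rigid mu &
    forall nu, GL_orbit mu nu -> has_weight (nth 0%N J_weights i) nu].
Proof.
have idempotent N a b c w : (N != 7)%N -> normal_form N a b c w ->
    (forall a' b' c' w', normal_form N a' b' c' w' ->
      [/\ a' = a, b' = b, c' = c & w' = w \/ w' = 0 /\ w != 0]) ->
    [/\ jordan_superalgebras K 1 3 (idempotent_mult a b c w), rigid (idempotent_mult a b c w) &
      forall nu, GL_orbit (idempotent_mult a b c w) nu -> has_weight N nu].
  move=> N7 nf uniq; split; [exact: normal_form_jordan nf | exact: normal_form_rigid nf uniq|].
  by move=> nu orb; rewrite /has_weight (negPf N7); exact: normal_form_orbit_invariants nf orb.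
have col100 : col3 1 0 0 != 0 :> 'cV[K]_3.
  by apply/eqP => /colP/(_ i0); rewrite !mxE => /eqP; rewrite oner_eq0.
have col001 : col3 0 0 1 != 0 :> 'cV[K]_3.
  by apply/eqP => /colP/(_ i2); rewrite !mxE => /eqP; rewrite oner_eq0.
rewrite (tnth_nth (J5 K)); case: i => -[|[|[|[|[|[|[|[|[|[|[|//]]]]]]]]]]] Hi /=.
- by split; [exact: J5_jordan | exact: J5_rigid | exact: J5_weight].
- rewrite J7E; apply: idempotent => //; first exact: NF7.
  by move=> a' b' c' w' nf; inversion nf; split=> //; left.
- rewrite J8E; apply: idempotent => //; first exact: NF8.
  by move=> a' b' c' w' nf; inversion nf; split=> //; left.
- rewrite J9E; apply: idempotent => //; first exact: NF9.
  by move=> a' b' c' w' nf; inversion nf; split=> //; left.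
- rewrite J11E; apply: idempotent => //; first exact: NF11.
  by move=> a' b' c' w' nf; inversion nf; split=> //; [right | left].
- rewrite J12E; apply: idempotent => //; first exact: NF12.
  by move=> a' b' c' w' nf; inversion nf; split=> //; left.
- rewrite J14E; apply: idempotent => //; first exact: NF14.
  by move=> a' b' c' w' nf; inversion nf; split=> //; [right | left].
- rewrite J15E; apply: idempotent => //; first exact: NF15.
  by move=> a' b' c' w' nf; inversion nf; split=> //; left.
- rewrite J16E; apply: idempotent => //; first exact: NF16.
  by move=> a' b' c' w' nf; inversion nf; split=> //; left.
- rewrite J17E; apply: idempotent => //; first exact: NF17.
  by move=> a' b' c' w' nf; inversion nf; split=> //; left.
- rewrite J19E; apply: idempotent => //; first exact: NF19.
  by move=> a' b' c' w' nf; inversion nf; split=> //; [right | left].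
Qed.

Lemma J_orbits_disjoint i j :
  GL_orbit (tnth (J_list K) i) `&` GL_orbit (tnth (J_list K) j) !=set0 -> i = j.
Proof.
move=> [mu [oi oj]].
have [_ _ /(_ _ oi) hi] := J_listP i; have [_ _ /(_ _ oj) hj] := J_listP j.
have /eqP := has_weight_inj hi hj.
by rewrite nth_uniq//= => /eqP/val_inj.
Qed.

End Rigidity.

(** * Superderivations *)

Section Derivations.
Context (K : fieldType) (m n : nat).
Implicit Types (mu nu : smult K m n) (D g : 'M[K]_(m + n)) (U W : {vspace 'M[K]_(m + n)}).

Definition superderivations mu := [set D | exists p, superderivation mu p D].

(** A containing subspace of least dimension works: its intersection with any other one is no
    smaller, hence equal to it. *)
Lemma is_Der_exists mu : exists U, is_Der mu U.
Proof.
pose contains W := superderivations mu `<=` [set D | D \in W].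
pose Q k := `[< exists2 W, contains W & \dim W = k >].
have exQ : exists k, Q k.
  exists (\dim {: 'M[K]_(m + n)}); apply/asboolP; exists fullv => // D _ /=.
  exact: memvf.
case: (ex_minnP exQ) => k /asboolP[U cU dU] kmin; exists U; split.
  by move=> p D dD; apply: cU; exists p.
move=> W cW; have cUW : contains (U :&: W)%VS.
  by move=> D [p dD] /=; rewrite memv_cap cU ?(cW p)//; exists p.
have /kmin : Q (\dim (U :&: W)) by apply/asboolP; exists (U :&: W)%VS.
rewrite -dU => le; have /eqP UW : (U :&: W == U)%VS by rewrite eqEdim capvSl.
by rewrite -UW capvSr.
Qed.

Lemma orbit_dim_exists mu : exists d, orbit_dim mu d.
Proof.
have [U dU] := is_Der_exists mu; exists ((m + n) ^ 2 - \dim U)%N; exists U => //.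
by rewrite subnK// -mulnn; have := dimvS (subvf U); rewrite dimvf dim_matrix.
Qed.

Lemma superderivation_conj mu nu g p D : graded_GL g ->
  (forall x y, smul nu (g *m x) (g *m y) = g *m smul mu x y) ->
  superderivation mu p D -> superderivation nu p (g *m D *m invmx g).
Proof.
move=> gg E [hD dD]; have ug := graded_GL_unit gg; have gV := graded_GLV gg.
split=> [i x hx|i j x y hx hy].
  rewrite -!mulmxA; apply: homogeneous_graded_GL => //; apply: hD.
  exact: homogeneous_graded_GL.
rewrite -{1}(mulKVmx ug x) -{1}(mulKVmx ug y) E -!mulmxA (mulKmx ug).
rewrite (dD i j); [|exact: homogeneous_graded_GL..].
rewrite mulmxDr -scalemxAr -!E !(mulKVmx ug) .
by [].
Qed.

(** Conjugation by [g] carries superderivations of [mu] injectively to those of [nu], so the bound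
    holds along the whole orbit. *)
Lemma orbit_dim_upper_bound mu nu (s : seq 'M[K]_(m + n)) d :
  GL_orbit mu nu -> free s -> {in s, forall D, superderivations mu D} ->
  orbit_dim nu d -> (d + size s <= (m + n) ^ 2)%N.
Proof.
move=> /GL_orbitP[g gg E] fs sD [U [cU _] <-]; rewrite leq_add2l.
have ug := graded_GL_unit gg.
pose f : 'End('M[K]_(m + n)) := linfun (mulmxr (invmx g) \o mulmx g).
have fE D : f D = g *m D *m invmx g by rewrite lfunE.
have kf : lker f = 0%VS.
  apply/eqP/lker0P => D D'; rewrite !fE => /(can_inj (mulmxKV ug)) /(can_inj (mulKmx ug)).
  by [].
have /eqP <- : \dim <<s>>%VS == size s by [].
rewrite -(limg_dim_eq (f := f)) ?kf ?capv0// limg_span; apply: dimvS.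
apply/span_subvP => _ /mapP[D /sD[p dD] ->]; apply: (cU p); rewrite fE.
exact: superderivation_conj dD.
Qed.

Lemma orbit_dim_exact mu (s : seq 'M[K]_(m + n)) d :
  free s -> {in s, forall D, superderivations mu D} ->
  superderivations mu `<=` [set D | D \in <<s>>%VS] ->
  (d + size s = (m + n) ^ 2)%N -> orbit_dim mu d.
Proof.
move=> fs sD cs ds; exists <<s>>%VS; last by rewrite -ds; congr (_ + _)%N; exact/eqP.
split=> [p D dD|W cW]; first by apply: cs; exists p.
by apply/span_subvP => D /sD[p dD]; exact: cW dD.
Qed.

Lemma free4 (M1 M2 M3 M4 : 'M[K]_(m + n)) :
  (forall a b c d, a *: M1 + b *: M2 + c *: M3 + d *: M4 = 0 ->
    [/\ a = 0, b = 0, c = 0 & d = 0]) -> free [:: M1; M2; M3; M4].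
Proof.
move=> H; apply/(freeP (X := [tuple M1; M2; M3; M4])) => k.
rewrite !big_ord_recl big_ord0 addr0 /= !addrA => /H[a b c d] i.
case: i => -[|[|[|[|//]]]] Hi.
- by rewrite -[RHS]a; congr k; exact: val_inj.
- by rewrite -[RHS]b; congr k; exact: val_inj.
- by rewrite -[RHS]c; congr k; exact: val_inj.
- by rewrite -[RHS]d; congr k; exact: val_inj.
Qed.

End Derivations.

Section DerivationsOfTypeOneThree.
Context (K : numFieldType).
Implicit Types (al a b c d p : K) (A B D : 'M[K]_3) (u v w x y z : 'cV[K]_3).
Implicit Types (r : 'rV[K]_3).

Definition even_map d D : 'M[K]_(1 + 3) := block_mx d%:M 0 0 D.
Definition odd_map r w : 'M[K]_(1 + 3) := block_mx 0 r w 0.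

Lemma even_map_vec d D a u : even_map d D *m vec a u = vec (d * a) (D *m u).
Proof. by rewrite /vec mul_block_col !mul0mx add0r addr0 -scalar_mxM. Qed.

Lemma odd_map_vec r w a u : odd_map r w *m vec a u = vec (dot r u) (a *: w).
Proof.
rewrite /vec mul_block_col !mul0mx add0r addr0 mul_mx_scalar; congr col_mx.
by rewrite [LHS]mx11_scalar.
Qed.

Lemma dot0 r : dot r 0 = 0.
Proof. by rewrite /dot mulmx0 mxE. Qed.

Lemma superderivation_even_map al A B d D :
  d * al = 0 -> D *m A = d *: A + A *m D ->
  (forall u v, d * oddform B u v = oddform B (D *m u) v + oddform B u (D *m v)) ->
  superderivation (mult1 al A B) false (even_map d D).
Proof.
move=> dal DA dB; split=> [i x|i j x y _ _].
  rewrite -{1}(vecK x); case: i => /homogeneous_vecP[a E]; apply/homogeneous_vecP; rewrite -(vecK x) E even_map_vec ?mulr0 ?mulmx0; by eexists.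
rewrite scale1r -(vecK x) -(vecK y).
move: (x _ 0) (dsubmx x) (y _ 0) (dsubmx y) => a u b v {x y}.
rewrite !even_map_vec !smul_mult1 even_map_vec vecD; congr vec.
  by rewrite mulrDr dB; apply: (lincomb dal (c := - (a * b))); ring.
rewrite mulmxDr -!scalemxAr !mulmxA DA !mulmxDl -!scalemxAl.
apply/colP => k; rewrite !(colDE, colZE); ring.
Qed.

(** The four hypotheses are the Leibniz rule at (e, e), (e, v), (u, e) and (u, v); the minus signs
    come from moving the odd map past [u]. *)
Lemma superderivation_odd_map al A B r w :
  al *: w = 2 *: (A *m w) ->
  (forall v, dot r (A *m v) = oddform B w v + al * dot r v) ->
  (forall u, dot r (A *m u) = al * dot r u - oddform B u w) ->
  (forall u v, oddform B u v *: w = dot r u *: (A *m v) - dot r v *: (A *m u)) ->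
  superderivation (mult1 al A B) true (odd_map r w).
Proof.
move=> ee eo oe oo; split=> [i x|i j x y].
  case: i => /homogeneous_vecP[a ->]; rewrite odd_map_vec; apply/homogeneous_vecP => /=.
    by rewrite scale0r; eexists.
  by rewrite /dot mulmx0 mxE; eexists.
case: i j => -[] /homogeneous_vecP[a ->] /homogeneous_vecP[b ->]; rewrite ?expr0 ?expr1.
all: rewrite !smul_mult1 !odd_map_vec !smul_mult1 ?vecZ ?vecD ?scaler0 ?scale0r ?mulmx0 ?oddform0l ?oddform0r.
all: rewrite ?mulr0 ?mul0r ?addr0 ?add0r ?scale1r ?mul1r ?mulmx0 ?scaler0 ?addr0 ?add0r ?scale0r.
- by rewrite dot0 oo mulr0 scaleN1r.
- rewrite dotZ oe oddformZr dot0 scale0r scaler0; congr vec; ring.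
- rewrite dotZ eo oddformZl dot0 scale0r; congr vec; ring.
- rewrite dot0 !mulr0 mul0r addr0 -!scalemxAr; congr vec.
  apply/colP => k; have /colP/(_ k) := ee; rewrite !(colDE, colZE) => H.
  by apply: (lincomb H (c := a * b)); ring.
Qed.

Lemma superderivation_commuting A D : D *m A = A *m D ->
  superderivation (mult1 1 A 0) false (even_map 0 D).
Proof.
move=> DA; apply: superderivation_even_map; first by rewrite mul0r.
  by rewrite scale0r add0r.
by move=> u v; rewrite !oddform_0 mul0r addr0.
Qed.

(** Four is 16 - 12, what an orbit dimension of at most 12 requires. *)
Definition four_derivations (mu : smult K 1 3) := exists s : seq 'M[K]_(1 + 3),
  [/\ free s, size s = 4 & {in s, forall M, superderivations mu M}].

Lemma four_derivations_intro (mu : smult K 1 3) (M1 M2 M3 M4 : 'M[K]_(1 + 3)) (p1 p2 p3 p4 : bool) :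
  free [:: M1; M2; M3; M4] ->
  superderivation mu p1 M1 -> superderivation mu p2 M2 ->
  superderivation mu p3 M3 -> superderivation mu p4 M4 ->
  four_derivations mu.
Proof.
move=> fM d1 d2 d3 d4; exists [:: M1; M2; M3; M4]; split=> // M.
by rewrite !inE => /or4P[] /eqP ->; eexists; eassumption.
Qed.

Lemma free_even_maps d1 D1 d2 D2 d3 D3 d4 D4 :
  (forall a b c d, a *: D1 + b *: D2 + c *: D3 + d *: D4 = 0 ->
    [/\ a = 0, b = 0, c = 0 & d = 0]) ->
  free [:: even_map d1 D1; even_map d2 D2; even_map d3 D3; even_map d4 D4].
Proof.
move=> H; apply: free4 => a b c d; rewrite !scale_block_mx !add_block_mx.
by move=> /(congr1 drsubmx); rewrite block_mxKdr /drsubmx !linear0 => /H.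
Qed.

Lemma free_even_maps_odd d1 D1 d2 D2 d3 D3 r w :
  (forall a b c, a *: D1 + b *: D2 + c *: D3 = 0 -> [/\ a = 0, b = 0 & c = 0]) ->
  (r != 0) || (w != 0) ->
  free [:: even_map d1 D1; even_map d2 D2; even_map d3 D3; odd_map r w].
Proof.
move=> H rw; apply: free4 => a b c d; rewrite !scale_block_mx !add_block_mx => E.
have := congr1 drsubmx E.
rewrite block_mxKdr /drsubmx !linear0 ?scaler0 addr0 => /H[-> -> ->].
split=> //; apply/eqP; move: rw; apply: contraLR => d0; rewrite negb_or !negbK.
have := congr1 ursubmx E; have := congr1 dlsubmx E.
rewrite block_mxKur block_mxKdl /ursubmx /dlsubmx !linear0 ?scaler0 !add0r.
by move=> /eqP; rewrite scaler_eq0 (negPf d0) /= => -> /eqP; rewrite scaler_eq0 (negPf d0) /= => ->.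
Qed.

Local Ltac mx3_ring := by apply/matrixP; do 2 elim/forall_ord3; rewrite !mxE !sum3E !mxE /=; ring.

(** With zero form, every matrix commuting with [A] is a derivation, and a repeated eigenvalue adds
    an off-diagonal one to the three diagonal ones. *)
Lemma four_derivations_scalar01 a b : four_derivations (idempotent_mult a a b 0).
Proof.
rewrite /idempotent_mult skew3_0.
apply: (@four_derivations_intro _ (even_map 0 (delta_mx i0 i0)) (even_map 0 (delta_mx i1 i1))
  (even_map 0 (delta_mx i2 i2)) (even_map 0 (delta_mx i0 i1)) false false false false).
- apply: free_even_maps => x y z t /matrixP E.
  have := (E i0 i0, E i1 i1, E i2 i2, E i0 i1); rewrite !mxE /=.
  by rewrite ?(mulr0, mulr1, addr0, add0r) => -[[[]]].
all: apply: superderivation_commuting; mx3_ring.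
Qed.

Lemma four_derivations_scalar12 a b : four_derivations (idempotent_mult a b b 0).
Proof.
rewrite /idempotent_mult skew3_0.
apply: (@four_derivations_intro _ (even_map 0 (delta_mx i0 i0)) (even_map 0 (delta_mx i1 i1))
  (even_map 0 (delta_mx i2 i2)) (even_map 0 (delta_mx i1 i2)) false false false false).
- apply: free_even_maps => x y z t /matrixP E.
  have := (E i0 i0, E i1 i1, E i2 i2, E i1 i2); rewrite !mxE /=.
  by rewrite ?(mulr0, mulr1, addr0, add0r) => -[[[]]].
all: apply: superderivation_commuting; mx3_ring.
Qed.

(** Traceless maps of the plane of [f2] and [f3] preserve the form, and the radical [f1] can be
    rescaled. *)
Lemma four_derivations_skew12 a b : four_derivations (idempotent_mult a b b (col3 1 0 0)).
Proof.
apply: (@four_derivations_intro _ (even_map 0 (delta_mx i0 i0)) (even_map 0 (delta_mx i1 i2))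
  (even_map 0 (delta_mx i2 i1)) (even_map 0 (diag3 0 (-1) 1)) false false false false).
- apply: free_even_maps => x y z t /matrixP E.
  have := (E i0 i0, E i1 i2, E i2 i1, E i2 i2); rewrite !mxE /=.
  by rewrite ?(mulr0, mulr1, addr0, add0r) => -[[[]]].
all: apply: superderivation_even_map; rewrite ?mul0r ?scale0r ?add0r //; first by mx3_ring.
all: by move=> u v; rewrite !oddform_skew3 !mxE !sum3E !mxE /=; ring.
Qed.

(** Traceless maps of the plane of [f1] and [f2], together with [f1 |-> f3] into the radical. *)
Lemma four_derivations_J19 : four_derivations (J19 K).
Proof.
rewrite J19E.
apply: (@four_derivations_intro _ (even_map 0 (delta_mx i0 i1)) (even_map 0 (delta_mx i1 i0))
  (even_map 0 (diag3 (-1) 1 0)) (even_map 0 (delta_mx i2 i0)) false false false false).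
- apply: free_even_maps => x y z t /matrixP E.
  have := (E i0 i1, E i1 i0, E i1 i1, E i2 i0); rewrite !mxE /=.
  by rewrite ?(mulr0, mulr1, addr0, add0r) => -[[[]]].
all: apply: superderivation_even_map; rewrite ?mul0r ?scale0r ?add0r //; first by mx3_ring.
all: by move=> u v; rewrite !oddform_skew3 !mxE !sum3E !mxE /=; ring.
Qed.

Lemma delta_row3_neq0 : delta_mx 0 i0 != 0 :> 'rV[K]_3.
Proof. by apply/eqP => /rowP/(_ i0); rewrite !mxE => /eqP; rewrite oner_eq0. Qed.

(** Two gradings, in which [e], [f1], [f2], [f3] have degrees 1, 0, 1, 0 and 1, -1, 0, 1; then
    [f3 |-> f2] and the odd map [f1 |-> e]. *)
Lemma four_derivations_J5 : four_derivations (J5 K).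
Proof.
rewrite J5E.
apply: (@four_derivations_intro _ (even_map 1 (diag3 0 1 0)) (even_map 0 (delta_mx i1 i2))
  (even_map 1 (diag3 (-1) 0 1)) (odd_map (delta_mx 0 i0) 0) false false false true).
- apply: free_even_maps_odd; last by rewrite delta_row3_neq0.
  move=> x y z /matrixP E.
  have := (E i1 i1, E i1 i2, E i2 i2); rewrite !mxE /=.
  by rewrite ?(mulr0, mulr1, addr0, add0r) => -[[]].
1-3: apply: superderivation_even_map; rewrite ?mulr0 //; first by mx3_ring.
1-3: by move=> u v; rewrite !oddform_skew3 !mxE !sum3E !mxE /=; ring.
apply: superderivation_odd_map.
- by rewrite mulmx0 !scaler0.
- by move=> v; rewrite J5_mulE !dotE !mxE /= oddform0l; ring.
- by move=> v; rewrite J5_mulE !dotE !mxE /= oddform0r; ring.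
- move=> u v; rewrite !J5_mulE scaler0 !dotE.
  by apply/colP; elim/forall_ord3; rewrite !(colDE, colNE, colZE) !mxE /=; ring.
Qed.

(** The odd one sends [e] to [f2], the eigenvector for 1/2, as the Leibniz rule for [e^2 = e]
    demands. *)
Definition J12_derivations : seq 'M[K]_(1 + 3) :=
  [:: even_map 0 (delta_mx i0 i0); even_map 0 (delta_mx i1 i1); even_map 0 (delta_mx i2 i2);
      odd_map 0 (delta_mx i1 0)].

Lemma J12_derivationsP :
  free J12_derivations /\ {in J12_derivations, forall M, superderivations (J12 K) M}.
Proof.
split.
  apply: free_even_maps_odd.
    move=> x y z /matrixP E.
    have := (E i0 i0, E i1 i1, E i2 i2); rewrite !mxE /=.
    by rewrite ?(mulr0, mulr1, addr0, add0r) => -[[]].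
  apply/orP; right; apply/eqP => /colP/(_ i1).
  by rewrite !mxE => /eqP; rewrite oner_eq0.
rewrite J12E /idempotent_mult skew3_0 => M.
rewrite !inE => /or4P[] /eqP ->.
1-3: by exists false; apply: superderivation_commuting; mx3_ring.
exists true; apply: superderivation_odd_map.
- rewrite scale1r diag3_mulE.
  by apply/colP; elim/forall_ord3; rewrite colZE !mxE /=; field.
- by move=> v; rewrite oddform_0 !dotE !mxE; ring.
- by move=> v; rewrite oddform_0 !dotE !mxE; ring.
- by move=> u v; rewrite oddform_0 !dotE !mxE !mul0r !addr0 !scale0r subrr.
Qed.

End DerivationsOfTypeOneThree.

Section Dimension.
Context (K : numFieldType).
Implicit Types (a b c d p : K) (A B : 'M[K]_3) (u v w x y z : 'cV[K]_3) (r : 'rV[K]_3).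

Lemma even_superderivationE (mu : smult K 1 3) (M : 'M[K]_(1 + 3)) :
  superderivation mu false M -> exists d D, M = even_map d D.
Proof.
move=> [hM _]; rewrite -(submxK M) [ulsubmx M]mx11_scalar.
exists (ulsubmx M 0 0), (drsubmx M); congr block_mx.
  apply/rowP => j; have /homogeneous_vecP[u Mu] := hM true _ (homogeneous_odd (delta_mx j 0)).
  have /matrixP/(_ (lshift 3 0) 0) := Mu.
  rewrite -{1}(submxK M) mul_block_col col_mxEu mxE raddf0 mulmx0 mxE add0r.
  by rewrite -colE mxE /vec col_mxEu raddf0 !mxE.
have /homogeneous_vecP[a Ma] := hM false _ (homogeneous_even 3 1).
apply/colP => j; have /matrixP/(_ (rshift 1 j) 0) := Ma.
rewrite -{1}(submxK M) mul_block_col col_mxEd mulmx0 addr0 mulmx1 /vec col_mxEd.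
by rewrite mxE => ->; rewrite mxE.
Qed.

Lemma odd_superderivationE (mu : smult K 1 3) (M : 'M[K]_(1 + 3)) :
  superderivation mu true M -> exists r w, M = odd_map r w.
Proof.
move=> [hM _]; rewrite -(submxK M).
exists (ursubmx M), (dlsubmx M); congr block_mx.
  have /homogeneous_vecP[u Mu] := hM false _ (homogeneous_even 3 1).
  apply/matrixP => i j; rewrite !ord1; have /matrixP/(_ (lshift 3 0) 0) := Mu.
  rewrite -{1}(submxK M) mul_block_col col_mxEu mulmx0 addr0 mulmx1 /vec col_mxEu.
  by rewrite raddf0 !mxE.
apply/matrixP => i j.
have /homogeneous_vecP[a Ma] := hM true _ (homogeneous_odd (delta_mx j 0)).
have /matrixP/(_ (rshift 1 i) 0) := Ma.
rewrite -{1}(submxK M) mul_block_col col_mxEd mxE raddf0 mulmx0 mxE add0r.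
by rewrite -colE mxE /vec col_mxEd !mxE.
Qed.

(** For an odd map, (e, e) puts [w] in the 1/2-eigenspace, (e, u) makes [r] vanish on [f1] and [f2],
    and (f3, f2) kills its last coordinate. For an even map, (e, e) gives [d = 0] and (e, u) makes
    [D] commute with a diagonal matrix with distinct entries. *)
Lemma J12_derivations_span :
  superderivations (J12 K) `<=` [set M | M \in <<J12_derivations K>>%VS].
Proof.
have sp M : M \in J12_derivations K -> M \in <<J12_derivations K>>%VS by exact: memv_span.
rewrite J12E /idempotent_mult skew3_0 => M [p dM] /=.
have E a := homogeneous_even 3 a; have O u := homogeneous_odd u.
pose e0 := col3 1 0 0 : 'cV[K]_3; pose e1 := col3 0 1 0 : 'cV[K]_3; pose e2 := col3 0 0 1 : 'cV[K]_3.
case: p dM => dM.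
- have [r [w ME]] := odd_superderivationE dM; rewrite ME in dM *; case: dM => _ dM.
  have := dM _ _ _ _ (E 1) (E 1).
  rewrite !smul_vecE !odd_map_vec !smul_vecE /= expr0 !scale1r vecD => /vec_inj[_].
  rewrite diag3_mulE => /colP wE.
  have w0 : w i0 0 = 0 by move: (wE i0); rewrite !(colDE, colZE) !col3E => H; apply: (lincomb H (c := 1)); ring.
  have w2 : w i2 0 = 0 by move: (wE i2); rewrite !(colDE, colZE) !col3E => H; apply: (lincomb H (c := -1)); ring.
  have rE u : dot r (diag3 0 2^-1 1 *m u) = dot r u.
    have := dM _ _ _ _ (E 1) (O u).
    rewrite !smul_vecE !odd_map_vec !smul_vecE /= expr0 !scale1r vecD => /vec_inj[+ _].
    by rewrite oddform_0 add0r mulr1 mul1r.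
  have r0 : r 0 i0 = 0.
    move: (rE e0); rewrite diag3_mulE !dotE !col3E => H; apply: (lincomb H (c := -1)); ring.
  have r1 : r 0 i1 = 0.
    by move: (rE e1); rewrite diag3_mulE !dotE !col3E => H; apply: (lincomb H (c := -2)); field.
  have := dM _ _ _ _ (O e2) (O e1).
  rewrite !smul_vecE !odd_map_vec !smul_vecE /= expr1 vecZ vecD => /vec_inj[_].
  move=> /colP/(_ i1); rewrite !(diag3_mulE, colDE, colZE, dotE) !col3E => H.
  have r2 : r 0 i2 = 0.
    by move: H; rewrite r1 oddform_0 => H; apply: (lincomb H (c := -2)); field.
  have -> : odd_map r w = w i1 0 *: odd_map 0 (delta_mx i1 0).
    rewrite /odd_map scale_block_mx !scaler0; congr block_mx.
      by apply/rowP; elim/forall_ord3; rewrite [RHS]mxE.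
    by apply/colP; elim/forall_ord3; rewrite colZE mxE /= ?mulr0 ?mulr1.
  by rewrite memvZ// sp// !inE eqxx !orbT.
- have [d [D ME]] := even_superderivationE dM; rewrite ME in dM *; case: dM => _ dM.
  have := dM _ _ _ _ (E 1) (E 1).
  rewrite !smul_vecE !even_map_vec !smul_vecE /= expr0 !scale1r vecD => /vec_inj[dE _].
  have d0 : d = 0 by apply: (lincomb dE (c := -1)); ring.
  have DA : D *m diag3 0 2^-1 1 = diag3 0 2^-1 1 *m D.
    apply: eq_mulmx_col => u; rewrite -!mulmxA.
    have := dM _ _ _ _ (E 1) (O u).
    rewrite !smul_vecE !even_map_vec !smul_vecE /= expr0 !scale1r vecD d0 => /vec_inj[_].
    by rewrite !mul0r !scale0r !add0r.
  have DA' i j : D i j * nth 0 [:: 0; 2^-1; 1] j = nth 0 [:: 0; 2^-1; 1] i * D i j.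
    by have /matrixP/(_ i j) := DA; rewrite mul_mx_diag mul_diag_mx !mxE.
  have -> : even_map d D = D i0 i0 *: even_map 0 (delta_mx i0 i0)
      + D i1 i1 *: even_map 0 (delta_mx i1 i1) + D i2 i2 *: even_map 0 (delta_mx i2 i2).
    rewrite /even_map !scale_block_mx !add_block_mx d0 raddf0 !scaler0 !addr0; congr block_mx.
    apply/matrixP => i j; have := DA' i j; move: i j.
    (* The six off-diagonal entries; the constants are inverse differences of eigenvalues. *)
    do 2 elim/forall_ord3; rewrite !mxE /= => H; rewrite ?(mulr0, mulr1, addr0, add0r) //.
    - by apply: (lincomb H (c := 2)); field.
    - by apply: (lincomb H (c := 1)); field.
    - by apply: (lincomb H (c := -2)); field.
    - by apply: (lincomb H (c := 2)); field.
    - by apply: (lincomb H (c := -1)); field.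
    - by apply: (lincomb H (c := -2)); field.
  by rewrite !memvD// !memvZ// sp// !inE eqxx ?orbT.
Qed.

Lemma J12_orbit_dim : orbit_dim (J12 K) 12.
Proof.
have [fs sD] := J12_derivationsP K.
exact: orbit_dim_exact fs sD J12_derivations_span _.
Qed.

Lemma J_list_four_derivations i : four_derivations (tnth (J_list K) i).
Proof.
rewrite (tnth_nth (J5 K)); case: i => -[|[|[|[|[|[|[|[|[|[|[|//]]]]]]]]]]] Hi /=.
- exact: four_derivations_J5.
- by rewrite J7E; exact: four_derivations_scalar01.
- by rewrite J8E; exact: four_derivations_scalar01.
- by rewrite J9E; exact: four_derivations_scalar01.
- by rewrite J11E; exact: four_derivations_skew12.
- by exists (J12_derivations K); have [fs sD] := J12_derivationsP K.
- by rewrite J14E; exact: four_derivations_skew12.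
- by rewrite J15E; exact: four_derivations_scalar01.
- by rewrite J16E; exact: four_derivations_scalar01.
- by rewrite J17E; exact: four_derivations_scalar12.
- exact: four_derivations_J19.
Qed.

End Dimension.

(** * Components and dimension of the variety *)

Section Main.
Context (K : numFieldType).
Local Notation JS := (jordan_superalgebras K 1 3).
Local Notation J i := (tnth (J_list K) i).

Lemma J_components :
  [set Z | irreducible_component JS Z] = [set closure (GL_orbit (J i)) | i in [set: 'I_11]].
Proof.
apply: (@components_closure_orbits _ JS 11 (fun i => GL_orbit (J i))).
- exact: closed_jordan_superalgebras.
- by move=> i mu orb; have [js _ _] := J_listP K i; exact: jordan_GL_orbit orb js.
- by move=> i; exact: irreducible_GL_orbit.
- by move=> i; have [] := J_listP K i.
- exact: J_orbits_disjoint.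
- by move=> mu js; have [i Jmu] := jordan_covered js; exists i.
Qed.

(** The listed orbit is open in the variety and meets the closure of the other one, hence meets that
    orbit itself. Thus an algebra that represents a component in [component_dim] is isomorphic to
    the listed one. *)
Lemma GL_orbit_of_closure_eq i mu : JS mu ->
  closure (GL_orbit (J i)) = closure (GL_orbit mu) -> GL_orbit (J i) mu.
Proof.
move=> js clE; have [Ji [U oU OU] _] := J_listP K i.
have JO : GL_orbit (J i) (J i) by exact: GL_orbit_refl.
have UJ : U (J i) by move: JO; rewrite {1}OU => -[].
have : closure (GL_orbit mu) (J i) by rewrite -clE; exact: subset_closure.
move=> /(_ U (open_nbhs_nbhs (conj oU UJ)))[nu [munu Unu]].
have Jnu : GL_orbit (J i) nu by rewrite OU; split=> //; exact: jordan_GL_orbit munu js.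
exact: GL_orbit_trans Jnu (GL_orbit_sym munu).
Qed.

Lemma J_variety_dim : variety_dim K 1 3 12.
Proof.
have comp Z : irreducible_component JS Z <-> exists i, closure (GL_orbit (J i)) = Z.
  have /seteqP[sub sup] := J_components.
  by split=> [/sub[i _ <-]|[i <-]]; [exists i | apply: sup; exists i].
split.
- move=> Z /comp[i <-]; have [d dJ] := orbit_dim_exists (J i).
  by exists d, (J i); split=> //; have [] := J_listP K i.
- have J12E : J (inord 5) = J12 K by rewrite (tnth_nth (J5 K)) inordK.
  exists (closure (GL_orbit (J (inord 5)))); first by apply/comp; exists (inord 5).
  exists (J (inord 5)); split=> //; first by have [] := J_listP K (inord 5).
  by rewrite J12E; exact: J12_orbit_dim.
- move=> Z d /comp[i <-] [mu [js clE dmu]].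
  have [s [fs s4 sD]] := J_list_four_derivations K i.
  have := orbit_dim_upper_bound (GL_orbit_of_closure_eq js clE) fs sD dmu.
  by rewrite s4 -[((1 + 3) ^ 2)%N]/(12 + 4)%N leq_add2r.
Qed.

Lemma jordan_closure_orbits : JS = closure (\bigcup_(i in [set: 'I_11]) GL_orbit (J i)).
Proof.
apply/seteqP; split.
  move=> mu js; have [i Jmu] := jordan_covered js; move: Jmu.
  by apply: closure_subset => nu Jnu; exists i.
rewrite [X in _ `<=` X]((closure_id JS).1 (@closed_jordan_superalgebras K 1 3)).
apply: closure_subset => mu [i _ orb]; have [js _ _] := J_listP K i.
exact: jordan_GL_orbit orb js.
Qed.

(** This makes the number of components exactly eleven. *)
Lemma J_closures_inj : injective (fun i => closure (GL_orbit (J i))).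
Proof.
move=> i j E; have [Ji _ _] := J_listP K i; have [Jj _ _] := J_listP K j.
apply: J_orbits_disjoint; exists (J j); split; last exact: GL_orbit_refl.
exact: GL_orbit_of_closure_eq.
Qed.

End Main.

Theorem theoremA (R : realType) :
  let JS := jordan_superalgebras (complex R) 1 3 in
  let J := fun i : 'I_11 => tnth (J_list (complex R)) i in
  [/\ variety_dim (complex R) 1 3 12,
      [set Z | irreducible_component JS Z]
        = [set closure (GL_orbit (J i)) | i in [set: 'I_11]],
      injective (fun i => closure (GL_orbit (J i))),
      forall i, JS (J i) /\ rigid (J i) &
      JS = closure (\bigcup_(i in [set: 'I_11]) GL_orbit (J i))].
Proof.
split.
- exact: J_variety_dim.
- exact: J_components.
- exact: J_closures_inj.
- by move=> i; have [] := J_listP (complex R) i.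
- exact: jordan_closure_orbits.
Qed.
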